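(* Let $K$ be a compact metric space without isolated points and let $d\in\mathbb{N}^+$. Then for the prevalent $f\in C(K,\mathbb{R}^d)$, for the generic $y\in f(K)$ the fiber $f^{-1}(y)$ is perfect. That is, the set of all $f\in C(K,\mathbb{R}^d)$ such that $\{y\in f(K): f^{-1}(y)\text{ is perfect}\}$ is co-meager in $f(K)$ is a prevalent subset of $C(K,\mathbb{R}^d)$.
   Context: $\mathbb{N}^+$ is the set of positive integers. $C(K,\mathbb{R}^d)$ is the set of continuous functions from $K$ to $\mathbb{R}^d$ with the supremum metric, regarded as an abelian Polish group under addition. For an abelian Polish group $G$, a set $A\subset G$ is shy (or Haar null) if there exist a Borel set $B\subset G$ and a Borel probability measure $\mu$ on $G$ such that $A\subset B$ and $\mu(B+x)=0$ for all $x\in G$. A set is prevalent if its complement is shy. ''For the prevalent $f$, $\mathcal{P}(f)$ holds'' means that the set of $f$ satisfying $\mathcal{P}$ is prevalent. ''Generic'' is in the sense of Baire category: a property holds for the generic element of a complete metric space $X$ if the set of elements having it is co-meager in $X$ (its complement is a countable union of nowhere dense sets). Here $X=f(K)$ with the metric inherited from $\mathbb{R}^d$. A set is perfect if it is closed and has no isolated points. *)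

(* Defs.v *)
From HB Require Import structures.
From mathcomp Require Import all_boot all_order all_algebra.
From mathcomp Require Import all_classical all_reals all_analysis.

Set Implicit Arguments.
Unset Strict Implicit.
Unset Printing Implicit Defensive.

Import Order.TTheory GRing.Theory Num.Theory.
Import numFieldNormedType.Exports.

Local Open Scope classical_set_scope.
Local Open Scope ring_scope.

Section baire_category.
Context {T : topologicalType}.
Implicit Types A : set T.

Definition nowhere_dense A := interior (closure A) = set0.

Definition meager A :=
  exists2 F : (set T)^nat, (forall n, nowhere_dense (F n)) & A = \bigcup_n F n.

Definition comeager A := meager (~` A).

End baire_category.

(* [borel G] is [G] with the sigma-algebra generated by its open sets; the
   point required by [measurableType] is [0]. *)
Definition pointed0 (G : Type) : Type := G.
HB.instance Definition _ (G : topologicalZmodType) :=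
  TopologicalZmodule.on (pointed0 G).
HB.instance Definition _ (G : topologicalZmodType) :=
  isPointed.Build (pointed0 G) (0 : G).

Notation borel G := (g_sigma_algebraType (@open (pointed0 G))).

Section haar_null.
Context (R : realType) {G : topologicalZmodType}.
Implicit Types A : set G.

Definition shy A :=
  exists (B : set (borel G)) (mu : probability (borel G) R),
    [/\ measurable B, A `<=` B &
        forall x : G, mu [set (b : G) + x | b in B] = 0%E].

Definition prevalent A := shy (~` A).

End haar_null.

(* C(K, V), for K compact, with pointwise operations and the supremum norm.
   The compactness proof [cK] is a parameter of the type because the supremum
   is finite only thanks to it. *)
Definition cont_space (R : realType) (K : topologicalType)
  (cK : compact [set: K]) (V : normedModType R) : Type := continuousType K V.

Section cont_space.
Context (R : realType) (K : topologicalType) (cK : compact [set: K]).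
Context (V : normedModType R).
Local Notation C := (cont_space cK V).
Implicit Types f g h : C.

HB.instance Definition _ := Choice.copy C (continuousType K V).

Let cts f : continuous (f : K -> V). Proof. exact: cts_fun. Qed.

Lemma cont_spaceP f g : (forall x, f x = g x) -> f = g.
Proof. by move=> fg; apply/continuousEP. Qed.

Let zero_cts : continuous (fun _ : K => 0 : V).
Proof. by move=> x; exact: cvg_cst. Qed.
Let add_cts f g : continuous (fun x => f x + g x).
Proof. by move=> x; apply: cvgD; exact: cts. Qed.
Let opp_cts f : continuous (fun x => - f x).
Proof. by move=> x; apply: cvgN; exact: cts. Qed.
Let scale_cts (a : R) f : continuous (fun x => a *: f x).
Proof. by move=> x; apply: cvgZl_tmp; exact: cts. Qed.

Let zero : C := mkcts zero_cts.
Let add f g : C := mkcts (add_cts (f := f) (g := g)).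
Let opp f : C := mkcts (opp_cts (f := f)).
Let scale (a : R) f : C := mkcts (scale_cts (a := a) (f := f)).

Let addA : associative add.
Proof. by move=> f g h; apply: cont_spaceP => x; exact: addrA. Qed.
Let addC : commutative add.
Proof. by move=> f g; apply: cont_spaceP => x; exact: addrC. Qed.
Let add0 : left_id zero add.
Proof. by move=> f; apply: cont_spaceP => x; exact: add0r. Qed.
Let addN : left_inverse zero opp add.
Proof. by move=> f; apply: cont_spaceP => x; exact: addNr. Qed.

HB.instance Definition _ := GRing.isZmodule.Build C addA addC add0 addN.

Let scaleA a b f : scale a (scale b f) = scale (a * b) f.
Proof. by apply: cont_spaceP => x; exact: scalerA. Qed.
Let scale1 : left_id 1 scale.
Proof. by move=> f; apply: cont_spaceP => x; exact: scale1r. Qed.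
Let scaleDr : right_distributive scale +%R.
Proof. by move=> a f g; apply: cont_spaceP => x; exact: scalerDr. Qed.
Let scaleDl f : {morph scale^~ f : a b / a + b}.
Proof. by move=> a b; apply: cont_spaceP => x; exact: scalerDl. Qed.

HB.instance Definition _ :=
  GRing.Zmodule_isLmodule.Build R C scaleA scale1 scaleDr scaleDl.

Definition sup_norm f : R := sup (range (fun x => `|f x|)).

Let norm_ub f : has_ubound (range (fun x => `|f x|)).
Proof.
have cf : {within [set: K], continuous (f : K -> V)}.
  by apply: continuous_subspaceT; exact: cts.
have [M [_ fM]] := compact_bounded (continuous_compact cf cK).
exists (M + 1) => _ [x _ <-].
by apply: (fM (M + 1)); [rewrite ltrDl | exists x].
Qed.

Let le_norm f x : `|f x| <= sup_norm f.
Proof. by apply: (ub_le_sup (norm_ub f)); exists x. Qed.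

Let norm_le f (e : R) : 0 <= e -> (forall x, `|f x| <= e) -> sup_norm f <= e.
Proof.
move=> e0 fe; have [[y Ky]|] := pselect (range (fun x => `|f x|) !=set0).
  by apply: ge_sup; [exists y | move=> _ [x _ <-]].
by move/set0P/negP; rewrite negbK /sup_norm => /eqP ->; rewrite sup0.
Qed.

Let norm_ge0 f : 0 <= sup_norm f.
Proof.
have [[y [x Kx fx]]|] := pselect (range (fun x => `|f x|) !=set0).
  exact: le_trans (le_norm f x).
by move/set0P/negP; rewrite negbK /sup_norm => /eqP ->; rewrite sup0.
Qed.

Let norm_triangle f g : sup_norm (f + g) <= sup_norm f + sup_norm g.
Proof.
apply: norm_le => [|x]; first exact: addr_ge0.
by apply: le_trans (ler_normD _ _) _; exact: lerD.
Qed.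

Let norm_scale (a : R) f : sup_norm (a *: f) = `|a| * sup_norm f.
Proof.
have H (b : R) g : sup_norm (b *: g) <= `|b| * sup_norm g.
  apply: norm_le => [|x]; first exact: mulr_ge0.
  by rewrite [(b *: g) x]/(b *: g x) normrZ ler_wpM2l.
apply/eqP; rewrite eq_le H /=.
have [->|a0] := eqVneq a 0; first by rewrite normr0 mul0r.
rewrite -ler_pdivlMl ?normr_gt0// -normfV.
by have := H a^-1 (a *: f); rewrite scalerA mulVf// scale1r.
Qed.

Let norm_eq0 f : sup_norm f = 0 -> f = 0.
Proof.
move=> f0; apply: cont_spaceP => x.
by apply: (@normr0_eq0 _ V); apply/eqP; rewrite eq_le normr_ge0 -f0 le_norm.
Qed.

HB.instance Definition _ :=
  Lmodule_isNormed.Build R C norm_triangle norm_scale norm_eq0.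

End cont_space.

(* Main.v *)
Require Import Defs.
From HB Require Import structures.
From mathcomp Require Import all_boot all_order all_algebra.
From mathcomp Require Import all_classical all_reals all_analysis.
From mathcomp Require Import measurable_realfun.
From mathcomp Require Import ring lra zify.

Set Implicit Arguments.
Unset Strict Implicit.
Unset Printing Implicit Defensive.

Import Order.TTheory GRing.Theory Num.Theory.
Import numFieldNormedType.Exports.

Local Open Scope classical_set_scope.
Local Open Scope ring_scope.

(** Say that [f] doubly covers an open set [W] of [K] when two disjoint subsets
    of [W] have images under [f] that contain a common nonempty open set of R^d.
    If [f] doubly covers every nonempty open set, then the fibers of [f] are
    generically perfect: a point of [f K] whose fiber has an isolated point has
    exactly one preimage in some member [W] of a countable base, and for a fixed
    [W] these points form a nowhere dense set, since arbitrarily near each of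
    them there is an open set all of whose points have two preimages in [W]
    ([comeager_perfect_fibers]).  So it suffices to find one Borel probability
    measure on C(K, R^d) such that, for every continuous [g], almost every [f]
    is such that [f + g] doubly covers every nonempty open set.

    The measure is the law of a random series of layers.  Level [m] carries a
    finite set of points of [K] with disjoint cells around them, and on the cell
    of each point the layer [m] is [r_(m+1)] times a random sign vector, where
    [r_m = (3/4)^m] and all the signs are independent.  Each point of level [m]
    has [B_(m+1)] children, points of level [m+1] whose cells lie inside its
    own, which is possible because [K] has no isolated point; the numbers [B_m]
    increase very fast.

    The difficulty is that [g] is arbitrary: on a cell of level [m] it may vary
    much more than [r_m], so values at neighboring points cannot be compared.
    The proof counts instead.  Fix a point [t] of level [n] and a horizon [L],
    and look at the fraction of the descendants of [t] of level [L] at which [g]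
    plus the layers of index less than [m] is within [r_m] of a target [y]. If
    [y'] is within [r_m / 2] of [y], then for each of these descendants one of
    the 2^d sign vectors moves the value to within [r_(m+1)] of [y']
    ([sign_vec_cover]).  Hence the expected fraction at level [m+1] for [y'] is
    at least 2^-d times the fraction at level [m] for [y].  The signs of
    different cells are independent and every cell of level [m] below [t] has
    the same weight, so the variance of the deviation is at most [1 / B_m]
    ([random_hits], [random_step]), which beats a union bound over finite nets
    of targets.  With probability at least [1 - 2^-n] the fractions thus remain
    positive up to level [L] for all targets close to an initial one.

    The initial targets come from two applications of the pigeonhole principle:
    each [t] has a target [y] in a finite net [Y] with fraction at least [1 /
    |Y|], and among [|Y| + 1] points [t] two share the same [y]
    ([double_cover_count]).  When [L] tends to infinity, compactness of the
    cells turns approximate values into exact ones ([cover_limit]); letting [n]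
    tend to infinity makes the exceptional set null ([robust_null]). *)

(** * Independent coin tosses on the unit interval *)

Section coin_tossing.
Context {R : realType}.

Fixpoint doubling (n : nat) (x : R) : R :=
  if n is n'.+1 then
    let y := doubling n' x in if 2^-1 <= y then 2 * y - 1 else 2 * y
  else x.

(** Binary digits of a uniform point of [0, 1] serve as independent fair coins:
    they are read off the orbit of the doubling map. *)
Definition coin (x : R) (n : nat) : bool := 2^-1 <= doubling n x.

Lemma measurable_doubling n :
  measurable_fun [set: measurableTypeR R] (doubling n : _ -> measurableTypeR R).
Proof.
elim: n => [|n IH]; first exact: measurable_id.
rewrite /=; apply: measurable_fun_ifT => /=.
- by apply: measurable_fun_ler => //; exact: measurable_cst.
- apply: measurable_funB; last exact: measurable_cst.
  by apply: measurable_funM => //; exact: measurable_cst.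
- by apply: measurable_funM => //; exact: measurable_cst.
Qed.

Lemma measurable_coin n :
  measurable ([set x | coin x n] : set (measurableTypeR R)).
Proof.
have -> : [set x | coin x n] =
    [set: measurableTypeR R] `&` (doubling n @^-1` [set` `[2^-1, +oo[]).
  by apply/seteqP; split => x /=; rewrite in_itv/= andbT // => -[].
by apply: measurable_doubling => //; exact: measurable_itv.
Qed.

Lemma doubling01 n x : 0 <= x <= 1 -> 0 <= doubling n x <= 1.
Proof.
move=> x01; elim: n => //= n; case: ifPn => [h|]; first by lra.
by rewrite -ltNge => h; lra.
Qed.

(** Binary expansion with remainder: the first [n] coins determine [x] up to an
    error of [2^-n] times a point of the orbit. *)
Lemma doublingE n x : x =
  \sum_(i < n) (coin x i)%:R * (2^-1) ^+ i.+1 + (2^-1) ^+ n * doubling n x.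
Proof.
elim: n => [|n IH]; first by rewrite big_ord0 add0r expr0 mul1r.
rewrite big_ord_recr/= {1}IH -addrA; congr (_ + _).
by rewrite exprS /coin; case: ifPn => _ /=; field.
Qed.

Definition extend_bits S (v : {ffun 'I_S -> bool}) (n : nat) : bool :=
  if insub n is Some i then v i else false.

Lemma extend_bitsE S (v : {ffun 'I_S -> bool}) (i : 'I_S) :
  extend_bits v i = v i.
Proof. by rewrite /extend_bits valK. Qed.

Definition coin_prob : probability (measurableTypeR R) R :=
  uniform_prob (@ltr01 R).

Lemma coin_prob_le (A : set (measurableTypeR R)) : measurable A ->
  (coin_prob A <= lebesgue_measure (A `&` [set` `[0%R, 1%R]]))%E.
Proof.
move=> mA; rewrite /coin_prob /= /uniform_prob integral_uniform_pdf.
rewrite -[leRHS]mul1e -integral_cst; last by apply: measurableI.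
rewrite le_eqVlt; apply/orP; left; apply/eqP; apply: eq_integral => x.
rewrite inE => -[_ /=]; rewrite in_itv/= /uniform_pdf => ->.
by rewrite subr0 invr1.
Qed.

Definition cylinder S (v : {ffun 'I_S -> bool}) : set (measurableTypeR R) :=
  [set x | forall i : 'I_S, coin x i = v i].

Lemma measurable_cylinder S (v : {ffun 'I_S -> bool}) :
  measurable (cylinder v).
Proof.
have -> : cylinder v = \bigcap_(i in [set: 'I_S])
    (if v i then [set x | coin x i] else ~` [set x | coin x i]).
  apply/seteqP; split => x.
    by move=> h i _; have := h i; case: (v i) => /= -> .
  by move=> h i; have := h i I; case: (v i) => //= /negP/negbTE.
apply: fin_bigcap_measurable => // i _.
by case: (v i); [|apply: measurableC]; exact: measurable_coin.
Qed.

(** Prescribing [S] coins confines a point of [0, 1] to a closed interval of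
    length [2^-S].  As an upper bound, this is insensitive to the two binary
    expansions of dyadic points. *)
Lemma coin_prob_cylinder S (v : {ffun 'I_S -> bool}) :
  (coin_prob (cylinder v) <= ((2^-1) ^+ S)%:E)%E.
Proof.
apply: (le_trans (coin_prob_le (measurable_cylinder v))).
pose a : R := \sum_(i < S) (v i)%:R * (2^-1) ^+ i.+1.
have pos : 0 < (2^-1 : R) ^+ S by rewrite exprn_gt0 // invr_gt0.
have -> : ((2^-1) ^+ S)%:E =
    lebesgue_measure ([set` `[a, a + (2^-1) ^+ S]] : set (measurableTypeR R)).
  by rewrite lebesgue_measure_itv/= lte_fin ltrDl pos -EFinB addrAC subrr add0r.
apply: le_measure; rewrite ?inE.
- by apply: measurableI => //; exact: measurable_cylinder.
- exact: measurable_itv.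
move=> x [xv /=]; rewrite !in_itv/= => x01.
have /andP[D0 D1] := doubling01 S x01.
rewrite (doublingE S x).
have -> : \sum_(i < S) (coin x i)%:R * (2^-1 : R) ^+ i.+1 = a.
  by apply: eq_bigr => i _; rewrite xv.
by rewrite lerDl lerD2l ler_piMr ?mulr_ge0 // ltW.
Qed.


(** Probabilities of events decided by finitely many coins reduce to counting in
    the finite space of coin patterns. *)
Lemma coin_prob_finite_event S (A : set (nat -> bool)) :
    (forall v w, (forall i, (i < S)%N -> v i = w i) -> A v -> A w) ->
  measurable ([set x | A (coin x)] : set (measurableTypeR R)) /\
  (coin_prob [set x | A (coin x)] <=
    (#|[pred v : {ffun 'I_S -> bool} | `[< A (extend_bits v) >]]|%:R
      * (2^-1) ^+ S)%:E)%E.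
Proof.
move=> AS.
set N := [pred v | _].
have -> : [set x | A (coin x)] = \big[setU/set0]_(v in N) cylinder v.
  apply/seteqP; split => x /=.
    move=> Ax; pose v := [ffun i : 'I_S => coin x i].
    rewrite (bigD1 v)/=; first by left => i; rewrite ffunE.
    apply: asboolT; apply: (AS (coin x)) => [i iS|//].
    by rewrite -[i]/(val (Ordinal iS)) extend_bitsE ffunE.
  apply: (big_ind (fun B : set R => B x -> A (coin x))) => //.
    by move=> B C hB hC [/hB|/hC].
  move=> v /asboolW Av xv; apply: (AS (extend_bits v)) => [i iS|//].
  by rewrite -[i]/(val (Ordinal iS)) extend_bitsE xv.
have mU (s : seq {ffun 'I_S -> bool}) (Q : pred _) :
    measurable (\big[setU/set0]_(v <- s | Q v) cylinder v).
  by apply: bigsetU_measurable => v _; exact: measurable_cylinder.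
split; first exact: mU.
rewrite -sum1_card natr_sum mulr_suml -sumEFin.
rewrite /index_enum; elim: (Finite.enum _) => [|v s IH].
  by rewrite !big_nil measure0.
rewrite !big_cons; case: ifPn => // _.
apply: le_trans (measureU2 _ _ _) _ => //; first exact: measurable_cylinder.
by apply: leeD => //; rewrite mul1r; exact: coin_prob_cylinder.
Qed.

End coin_tossing.

(** * Perfect fibers from double covers *)

Definition doubly_covers (K V : topologicalType) (f : K -> V) (O : set K) :=
  exists A1 A2 : set K, exists W : set V,
    [/\ A1 `<=` O, A2 `<=` O, A1 `&` A2 = set0, open W /\ W !=set0 &
        W `<=` f @` A1 /\ W `<=` f @` A2].

(** A fiber with an isolated point has exactly one point in some member [U i] of
    the base, so it is enough that, for each [i], the values [y] with exactly
    one preimage in [U i] form a nowhere dense set.  If they were dense in an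
    open set [W], then [U i] intersected with the preimage of [W] would be
    nonempty, hence doubly covered, and the common open set of values would
    contain such a [y], with two preimages in [U i]. *)
Lemma comeager_perfect_fibers (K V : topologicalType) (f : K -> V)
    (U : (set K)^nat) : accessible_space V -> continuous f ->
  (forall i, open (U i)) ->
  (forall x A, nbhs x A -> exists i, U i x /\ U i `<=` A) ->
  (forall O, open O -> O !=set0 -> doubly_covers f O) ->
  comeager [set y : set_type (range f) |
    perfect_set (f @^-1` [set set_val y])].
Proof.
move=> accV cf oU baseU dbl.
pose P := [set y : set_type (range f) | perfect_set (f @^-1` [set set_val y])].
pose lonely i := [set y : set_type (range f) |
  forall x x', U i x -> U i x' -> f x = set_val y -> f x' = set_val y -> x =
    x'].
pose F i := ~` P `&` [set y | lonely i y /\ exists2 x, U i x & f x = set_val y].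
have clf (y : set_type (range f)) : closed (f @^-1` [set set_val y]).
  by apply: closed_comp => [x _|]; [exact: cf|exact: accessible_closed_set1].
exists F; last first.
  apply/seteqP; split => [y nPy|y [i _ []]//].
  have : ~ (isolated (f @^-1` [set set_val y]) = set0).
    by move=> iso0; apply: nPy; apply/perfectP.
  move/eqP/set0P => -[x [/set_mem/= fx [A xA Afx]]].
  have [i [Uix UiA]] := baseU _ _ xA.
  exists i => //; split => //; split; last by exists x.
  move=> z z' Uz Uz' fz fz'.
  have sub : A `&` f @^-1` [set set_val y] `<=` [set x] by rewrite Afx.
  have -> : z = x by apply: (sub z); split => //; exact: UiA.
  by apply/esym/(sub z'); split => //; exact: UiA.
move=> i; apply/eqP; apply/negPn/negP => /set0P[y0].
move=> /[dup] /nbhs_singleton y0F [_ [[W oW <-] /= Wy0 WF]].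
have nbhsW (y : set_type (range f)) (B : set V) : open B -> B (set_val y) ->
    nbhs y (set_val @^-1` B).
  by move=> oB By; exists (set_val @^-1` B); split => //=; exists B.
have [y1 [[_ [_ [x1 Ux1 fx1]]] Wy1]] := y0F _ (nbhsW _ _ oW Wy0).
have [||A1 [A2 [B [A1O A2O A12 [oB [w Bw]] [BA1 BA2]]]]] :=
    dbl (U i `&` f @^-1` W).
- by apply: openI => //; apply: open_comp => // x _; exact: cf.
- by exists x1; split => //=; rewrite fx1.
have [a1 A1a1 fa1] := BA1 _ Bw.
have rw : w \in range f by rewrite inE; exists a1.
pose y2 : set_type (range f) := exist _ w rw.
have /WF y2F : W (set_val y2) by have [_ /=] := A1O _ A1a1; rewrite fa1.
have [y3 [[_ [lone _]] By3]] := y2F _ (nbhsW y2 _ oB Bw).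
have [b1 A1b1 fb1] := BA1 _ By3; have [b2 A2b2 fb2] := BA2 _ By3.
have [[Ub1 _] [Ub2 _]] := (A1O _ A1b1, A2O _ A2b2).
have b12 := lone _ _ Ub1 Ub2 fb1 fb2.
by have : (A1 `&` A2) b1 by [split => //; rewrite b12]; rewrite A12.
Qed.

(** * Points, cells and children in a perfect compact space *)

Section scheme.
Context {R : realType} {K : metricType R}.
Hypothesis cK : compact [set: K].
Hypothesis iK : isolated [set: K] = set0.

(** Each new point is chosen strictly farther from [q] than all the later ones,
    which makes the points distinct without a counting argument. *)
Lemma exists_close_points (q : K) (b : nat) (e : R) : 0 < e ->
  exists s : seq K, [/\ uniq s, size s = b, q \notin s &
    forall c, c \in s -> mdist q c < e].
Proof.
elim: b e => [|b IH] e e0; first by exists [::].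
have [c cq qc] : exists2 c, c != q & mdist q c < e.
  apply: contrapT => noc; suff : isolated [set: K] q by rewrite iK.
  split; first by rewrite inE.
  exists (ball q e); first exact: nbhsx_ballx.
  rewrite setIT ballEmdist; apply/seteqP; split => [y /= qy|y ->/=].
    by apply/eqP; apply: contraT => yq; exfalso; apply: noc; exists y.
  by rewrite mdistxx.
have [|s [us sb qs sc]] := IH (mdist q c); first by rewrite mdist_gt0 eq_sym.
exists (c :: s); split => /=.
- by rewrite us andbT; apply/negP => /sc; rewrite ltxx.
- by rewrite sb.
- by rewrite inE eq_sym negb_or cq.
- by move=> y; rewrite inE => /orP[/eqP ->//|/sc /lt_trans]; apply.
Qed.

Lemma seq_lower_bound (s : seq R) : (forall x, x \in s -> 0 < x) ->
  exists2 e, 0 < e & forall x, x \in s -> e <= x.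
Proof.
elim: s => [|x s IH] pos; first by exists 1.
have [y ys|e e0 es] := IH; first by apply: pos; rewrite inE ys orbT.
have x0 : 0 < x by apply: pos; rewrite inE eqxx.
exists (Num.min x e); first by rewrite lt_min x0.
by move=> y; rewrite inE ge_min => /orP[/eqP ->|/es ->]; rewrite ?lexx ?orbT.
Qed.

Lemma exists_finite_net (e : R) : 0 < e ->
  exists s : seq K, forall x, exists2 p, p \in s & mdist p x < e.
Proof.
move=> e0; have [[x0 _]|/set0P/negP] := pselect ([set: K] !=set0); last first.
  rewrite negbK => /eqP K0; exists [::] => x.
  by have : [set: K] x by []; rewrite K0.
(* Pointing [K] at [x0] gives access to the covering form of compactness. *)
pose Kp : ptopologicalType := HB.pack (K : Type) (Topological.on K)
  (isPointed.Build K x0).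
have : @compact Kp [set: K] by exact: cK.
rewrite compact_cover.
have h : [set: K] `<=` cover [set: K] (fun p : K => (ball p e)^°).
  by move=> x _; exists x => //; exact: nbhsx_ballx.
move=> /(_ K [set: K] _ (fun p _ => @open_interior _ (ball p e)) h) [D _ Dc].
exists (finmap.enum_fset D) => x; have [p /= pD /interior_subset px] := Dc x I.
by exists p => //; move: px; rewrite ballEmdist.
Qed.

(** The factor 4 keeps the balls of radius [2 * del] around the points disjoint;
    these balls will carry the bumps of one layer. *)
Definition separated (P : seq K) (del : R) :=
  {in P &, forall p p', p != p' -> 4 * del < mdist p p'}.

(** One level of the construction: the new points contain a net of [K], so that
    no open set is missed, and [b] children in each of the cells of [P]. *)
Lemma refine_points (P : seq K) (del eta : R) (b : nat) :
  0 < del -> 0 < eta ->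
  exists (P' : seq K) (del' : R) (ch : K -> seq K),
    [/\ uniq P', 0 < del' /\ del' <= eta, separated P' del',
        forall x, exists2 p, p \in P' & mdist p x < eta &
        forall q, q \in P -> [/\ uniq (ch q), size (ch q) = b,
          {subset ch q <= P'} &
          forall c x, c \in ch q -> mdist c x <= del' -> mdist q x <= del]].
Proof.
move=> del0 eta0.
have [ch chP] := choice (fun q : K => exists_close_points q b (divr_gt0 del0
  (ltr0n R 2))).
have [net netP] := exists_finite_net eta0.
pose P' := undup (net ++ flatten [seq ch q | q <- P]).
have [d|e e0 eP'] := @seq_lower_bound
    [seq d <- [seq mdist p p' | p <- P', p' <- P'] | 0 < d].
  by rewrite mem_filter => /andP[].
pose del' := Num.min (e / 5) (Num.min eta (del / 2)).
have del'0 : 0 < del' by rewrite !lt_min !divr_gt0 ?eta0.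
exists P', del', ch; split.
- exact: undup_uniq.
- by split => //; rewrite /del' !ge_min lexx orbT.
- move=> p p' Pp Pp' pp'; have : e <= mdist p p'.
    apply: eP'; rewrite mem_filter mdist_gt0 pp'.
    by apply/allpairsP; exists (p, p').
  have : del' <= e / 5 by rewrite /del' ge_min lexx.
  by lra.
- move=> x; have [p pn px] := netP x; exists p => //.
  by rewrite mem_undup mem_cat pn.
- move=> q qP; have [uq sq _ qc] := chP q; split => //.
    move=> c cq; rewrite mem_undup mem_cat; apply/orP; right.
    by apply/flattenP; exists (ch q) => //; exact: map_f.
  move=> c x /qc qc' cx; apply: le_trans (metric_triangle q c x) _.
  have : del' <= del / 2 by rewrite /del' !ge_min lexx !orbT.
  by lra.
Qed.

(** Iterating [refine_points] with a prescribed branching [B].  The cells of one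
    level do not cover [K]; density is recovered from the nets, which start new
    families of nested cells at every level. *)
Lemma exists_scheme (B : nat -> nat) :
  exists (P : nat -> seq K) (del : nat -> R) (ch : nat -> K -> seq K),
    [/\ forall m, uniq (P m),
        forall m, 0 < del m,
        forall m, separated (P m) (del m),
        forall m, del m.+1 <= m.+1%:R^-1 /\
          forall x, exists2 p, p \in P m.+1 & mdist p x < m.+1%:R^-1 &
        forall m q, q \in P m -> [/\ uniq (ch m q), size (ch m q) = B m.+1,
          {subset ch m q <= P m.+1} &
          forall c x, c \in ch m q -> mdist c x <= del m.+1 ->
            mdist q x <= del m]].
Proof.
pose good (a : nat * (seq K * R)) (b : (seq K * R) * (K -> seq K)) :=
  0 < a.2.2 -> [/\ uniq b.1.1, 0 < b.1.2 /\ b.1.2 <= a.1.+1%:R^-1,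
    separated b.1.1 b.1.2,
        forall x, exists2 p, p \in b.1.1 & mdist p x < a.1.+1%:R^-1 &
        forall q, q \in a.2.1 -> [/\ uniq (b.2 q), size (b.2 q) = B a.1.+1,
          {subset b.2 q <= b.1.1} &
          forall c x, c \in b.2 q -> mdist c x <= b.1.2 -> mdist q x <= a.2.2]].
have /(@choice _ _ good)[nxt nxtP] : forall a, exists b, good a b.
  move=> [m [P del]].
  have [del0|ndel] := pselect (0 < del); last first.
    by exists ([::], 1, fun=> [::]) => /= /ndel.
  have eta0 : 0 < m.+1%:R^-1 :> R by rewrite invr_gt0.
  have [P' [del' [ch H]]] := refine_points P (B m.+1) del0 eta0.
  by exists ((P', del'), ch) => _.
pose st := fix st m : seq K * R := if m is k.+1 then (nxt (k, st k)).1 else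
  ([::], 1).
have st0 m : 0 < (st m).2.
  by elim: m => //= m IH; have [_ []] := nxtP (m, st m) IH.
exists (fun m => (st m).1), (fun m => (st m).2), (fun m => (nxt (m, st m)).2).
split => //.
- by case=> //= m; have [] := nxtP (m, st m) (st0 m).
- by case=> //= m; have [] := nxtP (m, st m) (st0 m).
- by move=> m; have [_ [_ de] _ net _] := nxtP (m, st m) (st0 m).
- by move=> m q qP; have [_ _ _ _] := nxtP (m, st m) (st0 m); apply.
Qed.

End scheme.

(** * Sign vectors and the random series *)

Section sign_vectors.
Context {R : realType} {d : nat}.
Local Notation V := 'rV[R]_d.
Local Notation U := {ffun 'I_d -> bool}.

Lemma rV_norm_leP (z : V) (e : R) : 0 <= e ->
  (forall i, `|z ord0 i| <= e) <-> `|z| <= e.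
Proof.
move=> e0; rewrite [`|z|]mx_normrE; split => [h|/bigmax_leP[_ h] i].
  by apply: bigmax_le => // -[i j] _ /=; rewrite ord1.
exact: (h (ord0, i)).
Qed.

Definition sign_vec (u : U) : V := \row_i (if u i then 1 else -1).

Definition nearest_sign (z : V) : U := [ffun i => 0 <= z ord0 i].

Lemma sign_vec_norm u : `|sign_vec u| <= 1.
Proof.
by apply/rV_norm_leP => // i; rewrite mxE; case: (u i); rewrite ?normrN normr1.
Qed.

(** A ball of radius [2 * rho] for the max norm is a cube, hence the union of
    the 2^d cubes of half its size centered at the vectors [rho *: sign_vec u]. *)
Lemma sign_vec_cover (rho : R) (z : V) : 0 <= rho -> `|z| <= 2 * rho ->
  `|z - rho *: sign_vec (nearest_sign z)| <= rho.
Proof.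
move=> rho0 z2; apply/rV_norm_leP => // i; rewrite !mxE ffunE.
have /(_ i) := (rV_norm_leP z (mulr_ge0 (ler0n R 2) rho0)).2 z2.
by rewrite !ler_norml; case: ifPn; rewrite ?mulrN ?mulr1 -?ltNge; lra.
Qed.

(** Iterating [sign_vec_cover] yields finite nets of balls. *)
Lemma exists_ball_net (rho M : R) : 0 < rho ->
  exists s : seq V, forall z, `|z| <= M -> exists2 y, y \in s & `|z - y| <= rho.
Proof.
move=> rho0; have [k Mk] : exists k : nat, M <= rho * 2 ^+ k.
  have [k Mk] : exists k : nat, M / rho <= k%:R.
    by exists (Num.trunc (M / rho)).+1; rewrite ltW // truncnS_gt.
  exists k; rewrite -ler_pdivrMl // mulrC; apply: le_trans Mk _.
  by rewrite -natrX ler_nat ltnW // ltn_expl.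
elim: k M Mk => [|k IH] M Mk.
  exists [:: 0] => z zM; exists 0; rewrite ?inE // subr0.
  by apply: le_trans zM _; rewrite expr0 mulr1 in Mk.
have [s sP] := IH _ (lexx _).
exists [seq y + (rho * 2 ^+ k) *: sign_vec u | y <- s, u <- enum U] => z zM.
have [|y ys zy] := sP (z - (rho * 2 ^+ k) *: sign_vec (nearest_sign z)).
  apply: sign_vec_cover; first by rewrite mulr_ge0 ?exprn_ge0 // ltW.
  by apply: le_trans zM _; rewrite mulrCA -exprS.
exists (y + (rho * 2 ^+ k) *: sign_vec (nearest_sign z)).
  by apply/allpairsP; exists (y, nearest_sign z); rewrite /= mem_enum.
by rewrite opprD addrA addrAC.
Qed.

End sign_vectors.

Section random_function.
Context {R : realType} {K : metricType R} {d : nat}.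
Variables (P : nat -> seq K) (del : nat -> R).
Hypothesis P_uniq : forall m, uniq (P m).
Hypothesis del_gt0 : forall m, 0 < del m.
Hypothesis P_sep : forall m, separated (P m) (del m).
Local Notation V := 'rV[R]_d.

(** The ratio 3/4 is larger than 1/2 on purpose: a shift of size [rad m.+1] then
    handles all errors up to [2 * rad m.+1 = rad m + rad m / 2], which leaves
    room for moving the target by [rad m / 2] between two levels. *)
Definition rad (m : nat) : R := (3 / 4) ^+ m.

Lemma rad_gt0 m : 0 < rad m.
Proof. by rewrite exprn_gt0 // divr_gt0. Qed.

Lemma radS m : rad m.+1 = 3 / 4 * rad m.
Proof. exact: exprS. Qed.

Lemma rad_small (e : R) : 0 < e -> exists N, forall m, (N <= m)%N -> rad m < e.
Proof.
move=> e0; have lt1 : `|3 / 4 : R| < 1 by rewrite ger0_norm; lra.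
have /cvgrPdist_lt/(_ _ e0)[N _ NP] := cvg_geometric 1 lt1.
by exists N => m /NP /=; rewrite sub0r normrN mul1r ger0_norm // ltW ?rad_gt0.
Qed.

(** The coins are shared out injectively between the levels [m], the points of
    level [m], listed by [k], and the coordinates [i]. *)
Definition coin_index (m k i : nat) : nat := pickle (m, k, i).

Definition cell_signs (b : nat -> bool) m p : {ffun 'I_d -> bool} :=
  [ffun i => b (coin_index m (index p (P m)) (i : 'I_d))].

(** A continuous function equal to 1 on the cell of [p] and to 0 outside of the
    ball of twice the radius. *)
Definition plateau m (p x : K) : R :=
  Num.max 0 (Num.min 1 (2 - mdist p x / del m)).

Definition layer (b : nat -> bool) m (x : K) : V :=
  rad m.+1 *: \sum_(p <- P m) plateau m p x *: sign_vec (cell_signs b m p).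

Definition partial_map (b : nat -> bool) n (x : K) : V :=
  \sum_(m < n) layer b m x.

Lemma plateau01 m p x : 0 <= plateau m p x <= 1.
Proof.
by rewrite /plateau le_max lexx /= ge_max ler01 /= ge_min lexx.
Qed.

Lemma plateau1 m p x : mdist p x <= del m -> plateau m p x = 1.
Proof.
move=> px; rewrite /plateau; have : mdist p x / del m <= 1.
  by rewrite ler_pdivrMr // mul1r.
by move=> h; rewrite min_l ?max_r //; lra.
Qed.

Lemma plateau0 m p x : 2 * del m <= mdist p x -> plateau m p x = 0.
Proof.
move=> px; rewrite /plateau; have : 2 <= mdist p x / del m.
  by rewrite ler_pdivlMr.
by move=> h; apply: max_l; rewrite ge_min; apply/orP; right; lra.
Qed.

(** The supports of the bumps of one level are disjoint. *)
Lemma layer_sum b m p x : p \in P m -> mdist p x < 2 * del m ->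
  layer b m x = rad m.+1 *: (plateau m p x *: sign_vec (cell_signs b m p)).
Proof.
move=> pP px; rewrite /layer (bigD1_seq p) //= big_seq_cond big1 ?addr0 //.
move=> p' /andP[p'P p'p]; rewrite plateau0 ?scale0r //.
have := P_sep p'P pP p'p; have := metric_triangle p' x p.
have -> : mdist x p = mdist p x by exact: metric_sym.
by lra.
Qed.

Lemma layer_cell b m p x : p \in P m -> mdist p x <= del m ->
  layer b m x = rad m.+1 *: sign_vec (cell_signs b m p).
Proof.
move=> pP px; rewrite (layer_sum _ pP); last by have := del_gt0 m; lra.
by rewrite plateau1 // scale1r.
Qed.

Lemma layer_norm b m x : `|layer b m x| <= rad m.+1.
Proof.
have [[p pP px]|far] := pselect (exists2 p, p \in P m & mdist p x < 2 * del m).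
  rewrite (layer_sum _ pP px) !normrZ gtr0_norm ?rad_gt0 //.
  apply: ler_piMr; first exact/ltW/rad_gt0.
  have /andP[b0 b1] := plateau01 m p x.
  by rewrite ger0_norm //; apply: mulr_ile1 => //; exact: sign_vec_norm.
rewrite /layer big_seq big1 ?scaler0 ?normr0 ?ltW ?rad_gt0 // => p pP.
rewrite plateau0 ?scale0r // leNgt; apply/negP => px; apply: far; by exists p.
Qed.

Lemma continuous_mdist (p : K) : continuous (mdist p : K -> R).
Proof.
move=> x; apply/cvgrPdist_lt => e e0; near=> y.
have xy : mdist x y < e by near: y; have := nbhsx_ballx x e e0;
  rewrite ballEmdist.
have yx : mdist y x = mdist x y by exact: metric_sym.
have := metric_triangle p x y; have := metric_triangle p y x.
by rewrite ltr_norml; lra.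
Unshelve. all: by end_near. Qed.

Lemma continuous_plateau m p : continuous (plateau m p).
Proof.
move=> x; apply: (@continuous_max R K (cst 0) _ x); first exact: cvg_cst.
apply: (@continuous_min R K (cst 1) _ x); first exact: cvg_cst.
apply: cvgB; first exact: cvg_cst.
by apply: cvgM; [exact: continuous_mdist|exact: cvg_cst].
Qed.

Lemma continuous_sum_seq (I : Type) (s : seq I) (F : I -> K -> V) :
  (forall i, continuous (F i)) -> continuous (fun x => \sum_(i <- s) F i x).
Proof.
move=> cF; elim: s => [|i s IH].
  have -> : (fun x => \sum_(i <- [::]) F i x) = cst 0.
    by apply/funext => x; rewrite big_nil.
  by move=> x; exact: cvg_cst.
have -> : (fun x => \sum_(j <- i :: s) F j x) =
    (fun x => F i x + \sum_(j <- s) F j x).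
  by apply/funext => x; rewrite big_cons.
by move=> x; apply: cvgD; [exact: cF|exact: IH].
Qed.

Lemma continuous_layer b m : continuous (layer b m).
Proof.
move=> x; apply: cvgZl_tmp; move: x; apply: continuous_sum_seq => p x.
by apply: cvgZr_tmp; exact: continuous_plateau.
Qed.

Lemma continuous_partial_map b n : continuous (partial_map b n).
Proof. by apply: continuous_sum_seq => m; exact: continuous_layer. Qed.

Lemma partial_mapS b n x :
  partial_map b n.+1 x = partial_map b n x + layer b n x.
Proof. by rewrite /partial_map big_ord_recr. Qed.

Lemma partial_map_norm b n x : `|partial_map b n x| <= 3.
Proof.
have : `|partial_map b n x| <= 3 - 3 * rad n.
  elim: n => [|n IH]; first by rewrite /partial_map big_ord0 normr0 /rad expr0;
    lra.
  rewrite partial_mapS; apply: le_trans (ler_normD _ _) _.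
  by have := layer_norm b n x; rewrite radS; lra.
by have := rad_gt0 n; lra.
Qed.

(** The pointwise limit of the partial sums.  In each coordinate the partial sum
    of index [n] minus the tail bound [3 * rad n] is nondecreasing, and plus
    this bound it is nonincreasing, so that the supremum below is the limit and
    comes with its error estimate. *)
Definition limit_map b (x : K) : V :=
  \row_i sup (range (fun n => partial_map b n x ord0 i - 3 * rad n)).

Lemma limit_map_dist b n x : `|limit_map b x - partial_map b n x| <= 3 * rad n.
Proof.
apply/rV_norm_leP => [|i]; first by rewrite mulr_ge0 // ltW ?rad_gt0.
pose a k := partial_map b k x ord0 i.
have step k : `|a k.+1 - a k| <= rad k.+1.
  have := (rV_norm_leP (layer b k x) (ltW (rad_gt0 k.+1))).2 (layer_norm b k x).
  by rewrite /a partial_mapS mxE addrAC subrr add0r; apply.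
have dec k l : (k <= l)%N -> a l + 3 * rad l <= a k + 3 * rad k.
  elim: l => [|l IH]; first by rewrite leqn0 => /eqP ->.
  rewrite leq_eqVlt => /orP[/eqP -> //|/IH].
  by have := step l; rewrite ler_norml radS; lra.
have inc k l : (k <= l)%N -> a k - 3 * rad k <= a l - 3 * rad l.
  elim: l => [|l IH]; first by rewrite leqn0 => /eqP ->.
  rewrite leq_eqVlt => /orP[/eqP -> //|/IH].
  by have := step l; rewrite ler_norml radS; lra.
have ub : ubound (range (fun k => a k - 3 * rad k)) (a n + 3 * rad n).
  move=> _ [k _ <-]; have [kn|/ltnW nk] := leqP k n.
    by have := inc _ _ kn; have := rad_gt0 n; lra.
  by have := dec _ _ nk; have := rad_gt0 k; lra.
have lo : a n - 3 * rad n <= sup (range (fun k => a k - 3 * rad k)).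
  by apply: ub_le_sup; [exists (a n + 3 * rad n); exact: ub|exists n].
have hi : sup (range (fun k => a k - 3 * rad k)) <= a n + 3 * rad n.
  by apply: ge_sup => //; exists (a n - 3 * rad n); exists n.
by rewrite !mxE -/(a n) ler_norml; move: lo hi; rewrite /a; lra.
Qed.

Lemma continuous_limit_map b : continuous (limit_map b).
Proof.
move=> x; apply/cvgrPdist_lt => e e0.
have [N NP] := rad_small (divr_gt0 e0 (ltr0n R 9)).
have h y := limit_map_dist b N y.
have := NP _ (leqnn N) => rN.
have /cvgrPdist_lt/(_ _ (divr_gt0 e0 (ltr0n R 3))) cN :=
  @continuous_partial_map b N x.
near=> y; have xy : `|partial_map b N x - partial_map b N y| < e / 3.
  by near: y; exact: cN.
have -> : limit_map b x - limit_map b y =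
  (limit_map b x - partial_map b N x) + (partial_map b N x - partial_map b N y)
   - (limit_map b y - partial_map b N y).
  by rewrite addrA subrK opprB addrA subrK.
apply: le_lt_trans (ler_normB _ _) _.
have := ler_normD (limit_map b x - partial_map b N x) (partial_map b N x -
  partial_map b N y).
have := h x; have := h y; lra.
Unshelve. all: by end_near. Qed.

Definition layer_coins m : nat :=
  (\max_(k < size (P m)) \max_(i < d) (coin_index m k i).+1)%N.

Definition num_coins n : nat := (\max_(m < n) layer_coins m)%N.

Lemma coin_index_lt n m p (i : 'I_d) : (m < n)%N -> p \in P m ->
  (coin_index m (index p (P m)) i < num_coins n)%N.
Proof.
move=> mn pP; rewrite -index_mem in pP.
apply: leq_trans (leq_bigmax (Ordinal mn)) => /=.
apply: leq_trans (leq_bigmax (Ordinal pP)) => /=.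
exact: (leq_bigmax i).
Qed.

Lemma layer_eq b b' m x :
  (forall p, p \in P m -> cell_signs b m p = cell_signs b' m p) ->
  layer b m x = layer b' m x.
Proof.
move=> bb'; rewrite /layer big_seq [in RHS]big_seq; congr (_ *: _).
by apply: eq_bigr => p pP; rewrite bb'.
Qed.

Lemma partial_map_eq b b' n x :
  (forall i, (i < num_coins n)%N -> b i = b' i) ->
  partial_map b n x = partial_map b' n x.
Proof.
move=> bb'; apply: eq_bigr => m _; apply: layer_eq => p pP.
by apply/ffunP => i; rewrite !ffunE; apply: bb'; apply: coin_index_lt.
Qed.

End random_function.

(** * Second moments of sums over independent cells *)

Section second_moment.
Context {R : realFieldType} {Omega U : finType} {I : eqType}.
Variables (s : seq I) (act : I -> U -> Omega -> Omega) (D : I -> Omega -> R).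
Hypothesis act_inj : forall i u, injective (act i u).
Hypothesis D_act : forall i j u w, i \in s -> j \in s -> i != j ->
  D j (act i u w) = D j w.
Hypothesis D_mean0 : forall i w, i \in s -> \sum_(u : U) D i (act i u w) = 0.
Hypothesis D_le1 : forall i w, i \in s -> `|D i w| <= 1.
Hypothesis U_gt0 : (0 < #|U|)%N.

(** [act i] permutes the sample space by changing only the coins of [i].
    Averaging over these permutations kills [D i] and leaves [D j] unchanged, so
    the two variables are uncorrelated. *)
Lemma uncorrelated i j : i \in s -> j \in s -> i != j ->
  \sum_w D i w * D j w = 0.
Proof.
move=> si sj ij.
suff : #|U|%:R * (\sum_w D i w * D j w) = 0.
  by move=> /eqP; rewrite mulf_eq0 pnatr_eq0 -leqn0 leqNgt U_gt0 => /eqP.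
rewrite mulr_natl -sumr_const.
under eq_bigr => u _ do rewrite (reindex_inj (@act_inj i u)).
rewrite exchange_big big1 //= => w _.
transitivity ((\sum_(u : U) D i (act i u w)) * D j w); last first.
  by rewrite D_mean0 // mul0r.
rewrite mulr_suml.
by apply: eq_big => // u _; rewrite (D_act u w si sj ij).
Qed.

(** The off-diagonal terms vanish, so the second moment grows linearly in the
    number of summands instead of quadratically. *)
Lemma second_moment_le : uniq s ->
  \sum_w (\sum_(i <- s) D i w) ^+ 2 <= (size s * #|Omega|)%:R.
Proof.
move=> us.
have -> : \sum_w (\sum_(i <- s) D i w) ^+ 2 =
    \sum_(i <- s) \sum_(j <- s) \sum_w D i w * D j w.
  under eq_bigr => w _ do (rewrite expr2 mulr_suml;
    under eq_bigr => i _ do rewrite mulr_sumr).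
  by rewrite exchange_big; apply: eq_bigr => i _; rewrite exchange_big.
rewrite -sum1_size natrM natr_sum mulr_suml big_seq [leRHS]big_seq.
apply: ler_sum => i si; rewrite mul1r.
rewrite (bigD1_seq i) //= [X in _ + X]big_seq_cond.
rewrite [X in _ + X]big1 => [|j /andP[sj ji]].
  rewrite addr0 -sum1_card natr_sum; apply: ler_sum => w _.
  by rewrite -expr2 -real_normK ?num_real// expr_le1 // D_le1.
by rewrite uncorrelated // eq_sym.
Qed.

Lemma chebyshev_card (a : R) : uniq s -> 0 < a ->
  #|[pred w | (size s)%:R * a <= `|\sum_(i <- s) D i w|]|%:R
    * ((size s)%:R * a ^+ 2) <= #|Omega|%:R.
Proof.
move=> us a0; have [s0|s0] := posnP (size s).
  by rewrite s0 [X in _ * X]mul0r mulr0 ler0n.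
have sR : 0 < (size s)%:R :> R by rewrite ltr0n.
rewrite -(ler_pM2l sR) -[leRHS]natrM; apply: le_trans (second_moment_le us).
rewrite -sum1_card natr_sum mulrCA mulr_suml.
rewrite [leRHS](bigID [pred w | (size s)%:R * a <= `|\sum_(i <- s) D i w|]) /=.
rewrite -[leLHS]addr0; apply: lerD; last by apply: sumr_ge0 => w _;
  exact: sqr_ge0.
apply: ler_sum => w; rewrite inE => h.
rewrite mul1r -[leRHS]real_normK ?num_real// mulrA -expr2 -exprMn.
by rewrite lerXn2r ?nnegrE // mulr_ge0 // ltW.
Qed.

End second_moment.

Section random_hits.
Context {R : realFieldType} {Omega U : finType} {I L : eqType}.
Variables (s : seq I) (leaves : I -> seq L) (W : nat).
Variables (act : I -> U -> Omega -> Omega) (c : I -> Omega -> U).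
Variables (A : Omega -> L -> bool) (e : Omega -> L -> U).
Hypothesis s_uniq : uniq s.
Hypothesis U_gt0 : (0 < #|U|)%N.
Hypothesis W_gt0 : (0 < W)%N.
Hypothesis leavesW : forall i, i \in s -> size (leaves i) = W.
Hypothesis act_inj : forall i u, injective (act i u).
Hypothesis c_act_bij : forall i w, i \in s ->
  injective (fun u => c i (act i u w)).
Hypothesis c_act : forall i j u w, i \in s -> j \in s -> i != j ->
  c j (act i u w) = c j w.
Hypothesis A_act : forall i u w l, i \in s -> A (act i u w) l = A w l.
Hypothesis e_act : forall i u w l, i \in s -> e (act i u w) l = e w l.

Let p : R := #|U|%:R^-1.
Let D i w : R :=
  W%:R^-1 * \sum_(l <- leaves i) (A w l)%:R * ((c i w == e w l)%:R - p).

(** Each leaf [l] below [i] is present ([A w l]) or not, and asks for a value [e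
    w l] of the signs [c i w]; neither depends on the coins of [i].  Thus each
    present leaf is satisfied with conditional probability [1 / #|U|].  The
    deviations of different [i] are uncorrelated and of equal weight, so that
    the proportion of leaves that are present and satisfied falls short of its
    mean by [a] with probability at most [1 / (size s * a ^+ 2)]. *)
Lemma random_hits (a : R) : 0 < a ->
  #|[pred w | \sum_(i <- s) \sum_(l <- leaves i)
                  (A w l && (c i w == e w l))%:R <=
              p * (\sum_(i <- s) \sum_(l <- leaves i) (A w l)%:R)
                - (size s * W)%:R * a]|%:R
    * ((size s)%:R * a ^+ 2) <= #|Omega|%:R.
Proof.
move=> a0.
have U0 : 0 < #|U|%:R :> R by rewrite ltr0n.
have W0 : 0 < W%:R :> R by rewrite ltr0n.
have p01 : 0 <= p <= 1.
  by rewrite /p invr_ge0 ltW //= invf_le1 // ler1n.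
have D_act i j u w : i \in s -> j \in s -> i != j ->
    D j (act i u w) = D j w.
  move=> si sj ij; congr (_ * _); apply: eq_bigr => l _.
  by rewrite A_act // e_act // c_act.
have D_mean0 i w : i \in s -> \sum_(u : U) D i (act i u w) = 0.
  move=> si; rewrite -mulr_sumr exchange_big big1 ?mulr0 //= => l _.
  under eq_bigr => u _ do rewrite A_act // e_act //.
  rewrite -mulr_sumr sumrB sumr_const /p -[X in _ - X]mulr_natl.
  suff -> : \sum_(u : U) (c i (act i u w) == e w l)%:R = 1 :> R.
    by rewrite mulfV ?gt_eqF // subrr mulr0.
  transitivity (\sum_(u : U) (u == e w l)%:R : R).
    by rewrite [RHS](reindex_inj (@c_act_bij i w si)).
  by rewrite (bigD1 (e w l)) //= eqxx big1 ?addr0 // => u /negbTE ->.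
have D_le1 i w : i \in s -> `|D i w| <= 1.
  move=> si; rewrite normrM normfV (gtr0_norm W0) ler_pdivrMl // mulr1.
  apply: le_trans (ler_norm_sum _ _ _) _.
  rewrite -(leavesW si) -sum1_size natr_sum; apply: ler_sum => l _.
  rewrite normrM; case: (A w l); rewrite ?normr0 ?mul0r ?ler01 //.
  rewrite normr1 mul1r; case: (_ == _) => /=; rewrite ler_norml; lra.
apply: le_trans (chebyshev_card act_inj D_act D_mean0 D_le1 U_gt0 s_uniq a0).
apply: ler_wpM2r; first by rewrite mulr_ge0 ?sqr_ge0.
rewrite ler_nat.
apply: subset_leq_card; apply/fintype.subsetP => w; rewrite !inE => hw.
rewrite -normrN; apply: le_trans (ler_norm _).
have -> : \sum_(i <- s) D i w = W%:R^-1 *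
    (\sum_(i <- s) \sum_(l <- leaves i) (A w l && (c i w == e w l))%:R
    - p * (\sum_(i <- s) \sum_(l <- leaves i) (A w l)%:R)).
  rewrite mulrBr !mulr_sumr -sumrB; apply: eq_bigr => i _.
  rewrite -mulrBr !mulr_sumr -sumrB; congr (_ * _); apply: eq_bigr => l _.
  by case: (A w l); rewrite ?mul1r ?mulr1 // mul0r mulr0 subr0.
rewrite -mulrN ler_pdivlMl // opprB; rewrite natrM in hw; lra.
Qed.

End random_hits.

(** * Descendants of a point *)

Section descendants.
Context {R : realType} {K : metricType R}.
Variables (P : nat -> seq K) (del : nat -> R) (ch : nat -> K -> seq K).
Variable B : nat -> nat.
Hypothesis del_gt0 : forall m, 0 < del m.
Hypothesis P_sep : forall m, separated (P m) (del m).
Hypothesis chP : forall m q, q \in P m ->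
  [/\ uniq (ch m q), size (ch m q) = B m.+1, {subset ch m q <= P m.+1} &
      forall c x, c \in ch m q -> mdist c x <= del m.+1 -> mdist q x <= del m].

(** The descendants of [p], a point of level [n], that have level [n + l]. *)
Fixpoint desc n l p : seq K :=
  if l is l'.+1 then flatten [seq desc n.+1 l' c | c <- ch n p] else [:: p].

Definition ndesc n l : nat := (\prod_(i < l) B (n + i).+1)%N.

Lemma desc_level n l p : p \in P n -> {subset desc n l p <= P (n + l)%N}.
Proof.
elim: l n p => [|l IH] n p pP x /=; first by rewrite inE addn0 => /eqP ->.
have [_ _ cP _] := chP pP.
by move=> /flattenP[_ /mapP[c /cP c' ->] /(IH _ _ c')]; rewrite addSnnS.
Qed.

Lemma desc_cell n l p c x : p \in P n -> c \in desc n l p ->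
  mdist c x <= del (n + l)%N -> mdist p x <= del n.
Proof.
elim: l n p => [|l IH] n p pP /=; first by rewrite inE addn0 => /eqP ->.
have [_ _ cP cx] := chP pP.
move=> /flattenP[_ /mapP[c' /[dup] c'p /cP c'P ->] cc'].
by rewrite -addSnnS => /(IH _ _ c'P cc'); exact: cx.
Qed.

Lemma desc_in_cell n l p x : p \in P n -> x \in desc n l p -> mdist p x <= del
  n.
Proof. by move=> pP /(desc_cell pP); apply; rewrite mdistxx ltW. Qed.

Lemma size_desc n l p : p \in P n -> size (desc n l p) = ndesc n l.
Proof.
rewrite /ndesc; elim: l n p => [|l IH] n p pP /=; first by rewrite big_ord0.
have [_ sc cP _] := chP pP.
rewrite big_ord_recl /= addn0 -sc size_flatten /shape -map_comp.
rewrite sumnE big_map (eq_big_seq (fun=> \prod_(i < l) B (n + bump 0 i).+1)%N).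
  by rewrite big_const_seq count_predT iter_addn_0 mulnC.
by move=> c /cP cP' /=; rewrite IH //; apply: eq_bigr => i _; rewrite addSnnS.
Qed.

Lemma cells_disjoint m p p' x : p \in P m -> p' \in P m ->
  mdist p x <= del m -> mdist p' x <= del m -> p = p'.
Proof.
move=> pP p'P px p'x; apply/eqP; apply: contraT => pp'.
have := P_sep pP p'P pp'; have := metric_triangle p x p'.
have -> : mdist x p' = mdist p' x by exact: metric_sym.
by have := del_gt0 m; lra.
Qed.

(** Cells of the same level are disjoint and descendants stay in the cells of
    their ancestors. *)
Lemma uniq_desc n l p : p \in P n -> uniq (desc n l p).
Proof.
elim: l n p => [|l IH] n p pP //=.
have [uc _ cP _] := chP pP.
elim: (ch n p) uc cP => //= c s IHs /andP[cs us] csP.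
have cP : c \in P n.+1 by apply: csP; rewrite inE eqxx.
rewrite cat_uniq IH // IHs //=; last by move=> y ys; apply: csP;
  rewrite inE ys orbT.
rewrite andbT; apply/hasPn => x /flattenP[_ /mapP[c' c's ->] xc'].
have c'P : c' \in P n.+1 by apply: csP; rewrite inE c's orbT.
apply/negP => xc; move: cs; suff -> : c = c' by rewrite c's.
by apply: (cells_disjoint (x := x) cP c'P); apply: desc_in_cell; eassumption.
Qed.

(** Grouping the descendants by their ancestor of the intermediate level. *)
Lemma sum_desc (T : nmodType) n j l p (F : K -> T) :
  \sum_(x <- desc n (j + l) p) F x =
  \sum_(c <- desc n j p) \sum_(x <- desc (n + j) l c) F x.
Proof.
elim: j n p => [|j IH] n p /=; first by rewrite addn0 big_seq1.
rewrite !big_flatten /= !big_map; apply: eq_bigr => c _.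
by rewrite IH addSnnS.
Qed.

Lemma ndescD n j l : ndesc n (j + l) = (ndesc n j * ndesc (n + j) l)%N.
Proof.
rewrite /ndesc big_split_ord /=; congr (_ * _)%N.
by apply: eq_bigr => i _; rewrite addnA.
Qed.

Lemma ndesc_gt0 n l : (forall m, 0 < B m)%N -> (0 < ndesc n l)%N.
Proof. by move=> B0; rewrite prodn_gt0. Qed.

Lemma leq_ndesc n j : (forall m, 0 < B m)%N ->
  (B (n + j).+1 <= ndesc n j.+1)%N.
Proof.
move=> B0; rewrite /ndesc big_ord_recr /=.
by rewrite leq_pmull // prodn_gt0.
Qed.

End descendants.

(** * One level of the random series *)

Section random_step.
Context {R : realType} {K : metricType R} {d : nat}.
Variables (P : nat -> seq K) (del : nat -> R) (ch : nat -> K -> seq K).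
Variable B : nat -> nat.
Hypothesis P_uniq : forall m, uniq (P m).
Hypothesis del_gt0 : forall m, 0 < del m.
Hypothesis P_sep : forall m, separated (P m) (del m).
Hypothesis B_gt0 : forall m, (0 < B m)%N.
Hypothesis chP : forall m q, q \in P m ->
  [/\ uniq (ch m q), size (ch m q) = B m.+1, {subset ch m q <= P m.+1} &
      forall c x, c \in ch m q -> mdist c x <= del m.+1 -> mdist q x <= del m].
Variable g : K -> 'rV[R]_d.
Local Notation U := {ffun 'I_d -> bool}.

Definition hit (b : nat -> bool) m y x : bool :=
  `|partial_map P del b m x + g x - y| <= rad m.

Definition hits b m y (s : seq K) : R := \sum_(x <- s) (hit b m y x)%:R.

Definition flip_mask m p (u : U) (k : nat) : bool :=
  [exists i : 'I_d, (coin_index m (index p (P m)) i == k) && u i].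

Definition flip m S p (u : U) (w : {ffun 'I_S -> bool}) : {ffun 'I_S -> bool} :=
  [ffun k : 'I_S => w k (+) flip_mask m p u k].

Lemma flip_inj m S p u : injective (@flip m S p u).
Proof.
move=> w w' /ffunP ww'; apply/ffunP => k; have := ww' k.
by rewrite !ffunE => /addIb.
Qed.

Lemma flip_maskE m p u m' p' (i : 'I_d) : p \in P m -> p' \in P m' ->
  flip_mask m p u (coin_index m' (index p' (P m')) i) =
  [&& m == m', p == p' & u i].
Proof.
move=> pP p'P; apply/existsP/and3P.
  move=> [i' /andP[/eqP /(pcan_inj (@pickleK _))[mm' pp' ii'] ui']].
  subst m'; have -> : p = p' by rewrite -(nth_index p pP) pp' nth_index.
  by rewrite -(ord_inj ii').
by move=> [/eqP <- /eqP <- ui]; exists i; rewrite eqxx.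
Qed.

(** Flipping coins of the point [p] of level [m] acts on its sign vector as the
    translation by [u], and affects no other sign vector. *)
Lemma cell_signs_flip m S p u (w : {ffun 'I_S -> bool}) m' p' :
  p \in P m -> p' \in P m' -> (num_coins (d := d) P m'.+1 <= S)%N ->
  cell_signs P (extend_bits (flip m p u w)) m' p' =
  [ffun i => cell_signs P (extend_bits w) m' p' i (+)
    [&& m == m', p == p' & u i]] :> U.
Proof.
move=> pP p'P nS; apply/ffunP => i; rewrite !ffunE.
have lt : (coin_index m' (index p' (P m')) i < S)%N.
  by apply: leq_trans nS; apply: coin_index_lt.
have E (v : {ffun 'I_S -> bool}) := extend_bitsE v (Ordinal lt).
by rewrite /= in E; rewrite !E ffunE /= flip_maskE.
Qed.

Lemma leq_num_coins n n' : (n <= n')%N ->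
  (num_coins (d := d) P n <= num_coins (d := d) P n')%N.
Proof.
move=> nn'; apply/bigmax_leqP => i _.
exact: (leq_bigmax (widen_ord nn' i)).
Qed.

(** The leaves are the descendants of [tau] of the final level, and the
    independent cells are those of level [m = n + j] below [tau].  A leaf that
    hits [y] at level [m] is within [2 * rad m.+1] of [y'], hence hits [y'] at
    the next level as soon as the sign vector of its cell is the nearest one.
    The values of [g] at the leaves are arbitrary, since only the signs of level
    [m] are averaged. *)
Lemma random_step n j l tau y y' S (a : R) :
  tau \in P n -> `|y - y'| <= rad (n + j) / 2 ->
  (num_coins (d := d) P (n + j).+1 <= S)%N -> 0 < a ->
  #|[pred w : {ffun 'I_S -> bool} |
      hits (extend_bits w) (n + j).+1 y' (desc ch n (j + l) tau) <=
      #|U|%:R^-1 * hits (extend_bits w) (n + j) y (desc ch n (j + l) tau)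
        - (ndesc B n (j + l))%:R * a]|%:R * ((ndesc B n j)%:R * a ^+ 2)
    <= #|{ffun 'I_S -> bool}|%:R :> R.
Proof.
move=> tP yy' nS a0; set m := (n + j)%N in yy' nS *.
pose s := desc ch n j tau; pose leaves c := desc ch m l c.
have sP : {subset s <= P m} by exact: (desc_level chP).
have ss : size s = ndesc B n j by exact: (size_desc chP).
pose W := ndesc B m l.
pose c p (w : {ffun 'I_S -> bool}) : U := cell_signs P (extend_bits w) m p.
pose A (w : {ffun 'I_S -> bool}) x := hit (extend_bits w) m y x.
pose e (w : {ffun 'I_S -> bool}) x : U :=
  nearest_sign (y' - (partial_map P del (extend_bits w) m x + g x)).
have low p u (w : {ffun 'I_S -> bool}) x : p \in s ->
    partial_map P del (extend_bits (flip m p u w)) m x =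
    partial_map P del (extend_bits w) m x :> 'rV[R]_d.
  move=> ps; apply: eq_bigr => k _; apply: layer_eq => p' p'P.
  rewrite (cell_signs_flip u w (sP _ ps) p'P); last first.
    by apply: leq_trans (leq_num_coins _) nS; rewrite ltnS; exact: ltnW.
  by apply/ffunP => i; rewrite ffunE (gtn_eqF (ltn_ord k)) addbF.
have cact p p' u (w : {ffun 'I_S -> bool}) : p \in s -> p' \in s ->
    c p' (flip m p u w) = [ffun i => c p' w i (+) ((p == p') && u i)].
  move=> ps p's; rewrite /c (cell_signs_flip u w (sP _ ps) (sP _ p's) nS).
  by apply/ffunP => i; rewrite !ffunE eqxx.
have U_gt0 : (0 < #|{: U}|)%N by apply/card_gt0P; exists [ffun=> true].
apply: le_trans (random_hits (c := c) (A := A) (e := e) (leaves := leaves)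
  (act := @flip m S) (W := W) _ U_gt0 _ _ _ _ _ _ _ a0); last first.
- by move=> p u w x ps; rewrite /e (low p u w x ps).
- by move=> p u w x ps; rewrite /A /hit (low p u w x ps).
- move=> p p' u w ps p's pp'; rewrite (cact p p' u w ps p's) (negbTE pp').
  by apply/ffunP => i; rewrite ffunE addbF.
- move=> p w ps u u' /=; rewrite !(cact p p _ w ps ps) eqxx => /ffunP uu'.
  by apply/ffunP => i; have := uu' i; rewrite !ffunE /= => /addbI.
- by move=> p u; exact: flip_inj.
- by move=> p ps; rewrite /leaves (size_desc chP l (sP _ ps)).
- exact: (ndesc_gt0 m l B_gt0).
- exact: (uniq_desc del_gt0 P_sep chP j tP).
rewrite ss; apply: ler_wpM2r; first by rewrite mulr_ge0 ?sqr_ge0.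
rewrite ler_nat; apply: subset_leq_card; apply/fintype.subsetP => w.
rewrite !inE /hits !sum_desc -ndescD => h.
apply: le_trans h; rewrite big_seq [leRHS]big_seq; apply: ler_sum => p ps.
rewrite big_seq [leRHS]big_seq; apply: ler_sum => x xp.
rewrite ler_nat; case: (boolP (A w x)) => //= Awx.
case: (boolP (c p w == e w x)) => // /eqP cwx.
suff -> : hit (extend_bits w) m.+1 y' x by [].
have px : mdist p x <= del m := desc_in_cell del_gt0 chP (sP _ ps) xp.
rewrite /hit partial_mapS (layer_cell P_uniq del_gt0 P_sep _ (sP _ ps) px).
rewrite -[cell_signs _ _ _ _]/(c p w) cwx /e.
set z := y' - _; have zP : `|z| <= 2 * rad m.+1.
  have -> : z = - (partial_map P del (extend_bits w) m x + g x - y) - (y - y').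
    by apply/rowP => i; rewrite /z !mxE; ring.
  apply: le_trans (ler_normB _ _) _; rewrite normrN radS.
  by move: Awx; rewrite /A /hit; lra.
have := sign_vec_cover (ltW (rad_gt0 m.+1)) zP.
rewrite -normrN; congr (`|_| <= _).
by apply/rowP => i; rewrite /z !mxE; ring.
Qed.

End random_step.

(** * Probability of a double cover *)

Section covering_probability.
Context {R : realType} {K : metricType R} {d : nat}.
Variables (P : nat -> seq K) (del : nat -> R) (ch : nat -> K -> seq K).
Variable Y : nat -> seq 'rV[R]_d.
Local Notation U := {ffun 'I_d -> bool}.

(** Inverse of the proportion of hits that is guaranteed at level [m].  It loses
    at each level the factor [#|U|], the odds of a good sign vector, a factor 2
    for the deviation, and the size of the net, so that it also bounds the
    number of initial targets at every level. *)
Fixpoint inv_thr m : nat :=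
  if m is m'.+1 then (2 * #|{: U}| * inv_thr m' * size (Y m))%N
  else size (Y 0).

(** Large enough for Chebyshev's inequality to beat, by a factor [2 ^ m], the
    union bound over the targets of levels [m] and [m.+1] and over the starting
    points, for all starting levels before [m].  The last summand provides more
    children than initial targets. *)
Definition branching m : nat :=
  (2 ^ m * (2 * inv_thr m * size (Y m) * size (Y m.+1))
     * (2 * #|{: U}| * inv_thr m) ^ 2 + (size (Y m.+1)).+1)%N.

Local Notation B := branching.

Hypothesis YP : forall m z, `|z| <= m%:R + 5 ->
  exists2 y, y \in Y m & `|z - y| <= rad m / 4.
Hypothesis P_uniq : forall m, uniq (P m).
Hypothesis del_gt0 : forall m, 0 < del m.
Hypothesis P_sep : forall m, separated (P m) (del m).
Hypothesis chP : forall m q, q \in P m ->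
  [/\ uniq (ch m q), size (ch m q) = B m.+1, {subset ch m q <= P m.+1} &
      forall c x, c \in ch m q -> mdist c x <= del m.+1 -> mdist q x <= del m].

Lemma branching_gt0 m : (0 < B m)%N.
Proof. by rewrite /branching addnS. Qed.

Lemma size_net_gt0 m : (0 < size (Y m))%N.
Proof.
have [|y] := YP (m := m) (z := 0); first by rewrite normr0 addr_ge0.
by case: (Y m).
Qed.

Lemma card_signs_gt0 : (0 < #|{: U}|)%N.
Proof. by apply/card_gt0P; exists [ffun=> true]. Qed.

Lemma inv_thr_gt0 m : (0 < inv_thr m)%N.
Proof.
elim: m => [|m IH] /=; first exact: size_net_gt0.
by rewrite !muln_gt0 IH card_signs_gt0 size_net_gt0.
Qed.

Lemma leq_size_net_inv_thr m : (size (Y m) <= inv_thr m)%N.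
Proof.
case: m => //= m; rewrite leq_pmull // !muln_gt0 card_signs_gt0.
exact: inv_thr_gt0.
Qed.

Lemma leq_inv_thr m n : (m <= n)%N -> (inv_thr m <= inv_thr n)%N.
Proof.
elim: n => [|n IH]; first by rewrite leqn0 => /eqP ->.
rewrite leq_eqVlt => /orP[/eqP -> //|/IH h]; apply: leq_trans h _ => /=.
by rewrite mulnAC leq_pmull // !muln_gt0 card_signs_gt0 size_net_gt0.
Qed.

Section fixed_shift.
Variable g : K -> 'rV[R]_d.
Variable n : nat.
Hypothesis gn : forall x, `|g x| <= n%:R.

(** Half of the mean that the guaranteed proportion at level [m] ensures for the
    next level, so that the other half remains without bad luck. *)
Let slack m : R := (2 * #|{: U}| * inv_thr m)%:R^-1.

Local Notation hitsg := (hits P del g).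

Definition unlucky b m y y' s :=
  (`|y - y'| <= rad m / 2) &&
  (hitsg b m.+1 y' s <= #|{: U}|%:R^-1 * hitsg b m y s - (size s)%:R * slack m).

Lemma rad_le1 m : rad m <= 1 :> R.
Proof. by rewrite /rad exprn_ile1 //; lra. Qed.

Lemma map_norm b m x : `|partial_map P del b m x + g x| <= 3 + n%:R.
Proof.
apply: le_trans (ler_normD _ _) _; apply: lerD (gn x).
exact: partial_map_norm.
Qed.

Lemma hits_gt0 b m y s : 0 < hitsg b m y s -> exists2 x, x \in s & hit P del g
  b m y x.
Proof.
rewrite /hits => h; apply/hasP; apply: contraT; rewrite -all_predC => /allP no.
by move: h; rewrite big_seq big1 ?ltxx // => x /no /= /negbTE ->.
Qed.

(** At the first level each leaf hits some point of the net. *)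
Lemma hits_pigeonhole b s : (0 < size s)%N ->
  exists2 y, y \in Y n.+1 & (size s)%:R / (inv_thr n.+1)%:R <= hitsg b n.+1 y s.
Proof.
move=> s0.
have q0 : 0 < (inv_thr n.+1)%:R :> R by rewrite ltr0n inv_thr_gt0.
apply: contrapT => no.
have lt y : y \in Y n.+1 -> hitsg b n.+1 y s < (size s)%:R / (inv_thr n.+1)%:R.
  by move=> yY; rewrite ltNge; apply/negP => h; apply: no; exists y.
suff : (size s)%:R < (size s)%:R :> R by rewrite ltxx.
have : (size s)%:R <= \sum_(y <- Y n.+1) hitsg b n.+1 y s.
  rewrite /hits exchange_big /= -sum1_size natr_sum; apply: ler_sum => x _.
  have [|y yY xy] := YP (m := n.+1) (z := partial_map P del b n.+1 x + g x).
    by apply: le_trans (map_norm _ _ _) _; rewrite -(natr1 n); lra.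
  rewrite (big_rem y) //= /hit (_ : _ <= rad _); last first.
    by apply: le_trans xy _; have := rad_gt0 (R := R) n.+1; lra.
  by rewrite lerDl sumr_ge0.
move=> /le_lt_trans; apply.
apply: (@lt_le_trans _ _ (\sum_(y <- Y n.+1) (size s)%:R / (inv_thr n.+1)%:R)).
  rewrite big_seq [ltRHS]big_seq; apply: ltr_sum => //.
  by have := size_net_gt0 n.+1; case: (Y n.+1) => // y l _; apply/hasP;
    exists y; rewrite ?inE eqxx.
rewrite big_const_seq count_predT iter_addr_0 -[leLHS]mulr_natr mulrAC.
rewrite ler_pdivrMr // -!natrM ler_nat leq_mul2l leq_size_net_inv_thr.
by rewrite orbT.
Qed.

(** Without bad luck, the proportion of hits stays positive along targets that
    approximate the given [y0] better and better, so some leaf gets close to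
    [y0] at the final level. *)
Lemma hits_chain b s k y y0 : (0 < size s)%N ->
  (forall i, (i < k)%N -> forall y y', y \in Y (n + i.+1)%N ->
    y' \in Y (n + i.+1).+1 -> ~~ unlucky b (n + i.+1) y y' s) ->
  y \in Y n.+1 -> (size s)%:R / (inv_thr n.+1)%:R <= hitsg b n.+1 y s ->
  `|y0 - y| <= rad n.+1 / 4 ->
  exists2 x, x \in s & `|partial_map P del b (n + k.+1) x + g x - y0|
     <= 2 * rad (n + k.+1).
Proof.
move=> s0 lucky yY hy y0y.
have thr0 m : 0 < (size s)%:R / (inv_thr m)%:R :> R.
  by rewrite divr_gt0 // ltr0n // inv_thr_gt0.
have y0n : `|y0| <= n%:R + 6.
  have [x xs xy] := hits_gt0 (lt_le_trans (thr0 _) hy).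
  have -> : y0 = (y0 - y) - (partial_map P del b n.+1 x + g x - y)
      + (partial_map P del b n.+1 x + g x).
    by apply/rowP => i; rewrite !mxE; ring.
  apply: le_trans (ler_normD _ _) _.
  have := ler_normB (y0 - y) (partial_map P del b n.+1 x + g x - y).
  have := map_norm b n.+1 x; have := rad_le1 n.+1.
  by move: xy; rewrite /hit; lra.
have chain i : (i <= k)%N -> exists y', [/\ y' \in Y (n + i.+1)%N,
    `|y0 - y'| <= rad (n + i.+1) / 4 &
    (size s)%:R / (inv_thr (n + i.+1))%:R <= hitsg b (n + i.+1) y' s].
  elim: i => [|i IH] ik; first by exists y; rewrite addn1.
  have [y1 [y1Y y01 hy1]] := IH (ltnW ik).
  have [|y2 y2Y y02] := YP (m := (n + i.+2)%N) (z := y0).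
    by apply: le_trans y0n _; rewrite natrD -!(natr1 i.+1) -!(natr1 i);
      have : 0 <= i%:R :> R by []; lra.
  exists y2; split => //.
  move: y2Y y02; rewrite addnS => y2Y y02.
  have := lucky i ik y1 y2 y1Y y2Y; rewrite /unlucky negb_and -!ltNge.
  move=> /orP[|].
    rewrite ltNge => /negP[]; have -> : y1 - y2 = (y0 - y2) - (y0 - y1).
      by apply/rowP => j; rewrite !mxE; ring.
    apply: le_trans (ler_normB _ _) _; move: y02; rewrite radS.
    by have := rad_gt0 (R := R) (n + i.+1); lra.
  move=> /ltW; apply: le_trans.
  have -> : (size s)%:R / (inv_thr (n + i.+1).+1)%:R =
      (size s)%:R * slack (n + i.+1) / (size (Y (n + i.+1).+1))%:R.
    by rewrite /slack /= natrM invfM mulrA.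
  set c := #|{: U}|%:R^-1 : R.
  have c0 : 0 < c by rewrite invr_gt0 ltr0n card_signs_gt0.
  have -> : slack (n + i.+1) = c * (inv_thr (n + i.+1))%:R^-1 / 2.
    by rewrite /slack !natrM !invfM /c [in RHS]mulrC mulrA.
  apply: (@le_trans _ _ ((size s)%:R * (c * (inv_thr (n + i.+1))%:R^-1 / 2))).
    rewrite ler_pdivrMr ?ltr0n ?size_net_gt0 // ler_peMr ?ler1n ?size_net_gt0
      //.
    by rewrite !mulr_ge0 ?invr_ge0 // ltW.
  have := ler_wpM2l (ltW c0) hy1; lra.
have [y' [_ y0y' h]] := chain k (leqnn k).
have [x xs xy'] := hits_gt0 (lt_le_trans (thr0 _) h).
exists x => //; have -> : partial_map P del b (n + k.+1) x + g x - y0 =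
   (partial_map P del b (n + k.+1) x + g x - y') - (y0 - y').
  by apply/rowP => i; rewrite !mxE; ring.
apply: le_trans (ler_normB _ _) _; move: xy'; rewrite /hit.
by have := rad_gt0 (R := R) (n + k.+1); lra.
Qed.

Definition near_image b k tau (y0 : 'rV[R]_d) := exists x,
  mdist tau x <= del n /\
  `|partial_map P del b (n + k.+1) x + g x - y0| <= 2 * rad (n + k.+1).

Definition double_cover (T : seq K) b k := exists tau tau' y,
  [/\ tau \in T, tau' \in T, tau != tau', y \in Y n.+1 & forall y0,
    `|y0 - y| <= rad n.+1 / 4 ->
    near_image b k tau y0 /\ near_image b k tau' y0].

Section union_bound.
Variable T : seq K.
Hypothesis TP : {subset T <= P n}.
Hypothesis T_uniq : uniq T.
Hypothesis T_size : size T = (size (Y n.+1)).+1.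
Variable k : nat.

Let bad_luck b : nat :=
  (\sum_(tau <- T) \sum_(i < k) \sum_(y <- Y (n + i.+1))
   \sum_(y' <- Y (n + i.+1).+1)
     unlucky b (n + i.+1) y y' (desc ch n k.+1 tau))%N.

(** There are more starting points than initial targets, so two of the starting
    points share a target. *)
Lemma double_cover_lucky b : bad_luck b = 0%N -> double_cover T b k.
Proof.
move=> lucky; pose s tau := desc ch n k.+1 tau.
have s0 tau : tau \in T -> (0 < size (s tau))%N.
  by move=> /TP tP; rewrite (size_desc chP _ tP) ndesc_gt0 //;
    exact: branching_gt0.
have pick tau : exists y, tau \in T -> y \in Y n.+1 /\
    (size (s tau))%:R / (inv_thr n.+1)%:R <= hitsg b n.+1 y (s tau).
  have [tT|] := boolP (tau \in T); last by exists 0.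
  by have [y yY hy] := hits_pigeonhole b (s0 _ tT); exists y.
have [f fP] := choice pick.
have [tau [tau' [tT t'T tt' ff]]] : exists tau tau',
    [/\ tau \in T, tau' \in T, tau != tau' & f tau = f tau'].
  apply: contrapT => inj; have : (size T <= size (Y n.+1))%N.
    rewrite -(size_map f); apply: uniq_leq_size.
      rewrite map_inj_in_uniq // => tau tau' tT t'T ff.
      by apply/eqP; apply: contraT => tt'; exfalso; apply: inj;
        exists tau, tau'.
    by move=> _ /mapP[tau tT ->]; have [] := fP _ tT.
  by rewrite T_size ltnn.
have cover t : t \in T -> forall y0, `|y0 - f t| <= rad n.+1 / 4 ->
    near_image b k t y0.
  move=> {}tT y0 y0f; have [fY fh] := fP _ tT.
  have [|x xs xy] := hits_chain (k := k) (s0 _ tT) _ fY fh y0f.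
    move=> i ik y y' yY y'Y; apply/negP => bad.
    suff : (0 < bad_luck b)%N by rewrite lucky.
    rewrite /bad_luck (big_rem t) //= ltn_addr //.
    rewrite (bigD1 (Ordinal ik)) //= ltn_addr //.
    by rewrite (big_rem y) //= ltn_addr // (big_rem y') //= bad.
  exists x; split => //; exact: (desc_in_cell del_gt0 chP (TP tT) xs).
have [fY _] := fP _ tT; exists tau, tau', (f tau); split => // y0 y0f.
split; apply: cover => //.
by rewrite -ff.
Qed.

Lemma unlucky_count S i tau y y' : (i < k)%N -> tau \in T ->
  (num_coins (d := d) P (n + k.+1) <= S)%N ->
  #|[pred w : {ffun 'I_S -> bool} |
     unlucky (extend_bits w) (n + i.+1) y y' (desc ch n k.+1 tau)]|%:R
    * (B (n + i.+1))%:R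
  <= #|{ffun 'I_S -> bool}|%:R * (2 * #|{: U}| * inv_thr (n + i.+1))%:R ^+ 2 :>
    R.
Proof.
move=> ik /TP tP nS; set m := (n + i.+1)%N; set N := #|[pred w | _]|.
have [yy'|nyy'] := boolP (`|y - y'| <= rad m / 2); last first.
  rewrite /N (eq_card0 (A := [pred w | _])) ?mul0r ?mulr_ge0 ?sqr_ge0 //.
  by move=> w; rewrite !inE /unlucky (negbTE nyy').
have q0 : 0 < (2 * #|{: U}| * inv_thr m)%:R :> R.
  by rewrite ltr0n !muln_gt0 card_signs_gt0 inv_thr_gt0.
have sl0 : 0 < slack m by rewrite invr_gt0.
have eqk : (i.+1 + (k - i) = k.+1)%N by rewrite addSn subnKC // ltnW.
have mS : (num_coins (d := d) P m.+1 <= S)%N.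
  by apply: leq_trans (leq_num_coins _ _) nS; rewrite -addnS leq_add2l ltnS.
have := random_step P_uniq del_gt0 P_sep branching_gt0 chP g (k - i) tP yy' mS
  sl0.
rewrite eqk.
have -> : ndesc B n k.+1 = size (desc ch n k.+1 tau).
  by rewrite (size_desc chP _ tP).
have NE : N = #|[pred w : {ffun 'I_S -> bool} |
    hitsg (extend_bits w) m.+1 y' (desc ch n k.+1 tau) <=
    #|{: U}|%:R^-1 * hitsg (extend_bits w) m y (desc ch n k.+1 tau)
      - (size (desc ch n k.+1 tau))%:R * slack m]|.
  by apply: eq_card => w; rewrite !inE /unlucky yy'.
rewrite -NE => h; rewrite -ler_pdivrMr ?exprn_gt0 //; apply: le_trans h.
rewrite -mulrA -exprVn; apply: ler_wpM2l => //.
rewrite ler_wpM2r ?sqr_ge0 // ler_nat /m addnS.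
apply: leq_ndesc; exact: branching_gt0.
Qed.

Lemma double_cover_count S : (num_coins (d := d) P (n + k.+1) <= S)%N ->
  #|[pred w : {ffun 'I_S -> bool} |
      ~~ `[< double_cover T (extend_bits w) k >]]|%:R
  <= (2^-1) ^+ n * #|{ffun 'I_S -> bool}|%:R :> R.
Proof.
move=> nS; set Om := #|{ffun 'I_S -> bool}|%:R : R.
apply: (@le_trans _ _ (\sum_(w : {ffun 'I_S -> bool})
    (bad_luck (extend_bits w))%:R)).
  rewrite -sum1_card natr_sum big_mkcond; apply: ler_sum => w _ /=.
  rewrite inE; case: ifPn => // /asboolPn nd.
  rewrite ler1n lt0n; apply/eqP => /double_cover_lucky; exact: nd.
pose N (tau : K) (i : nat) y y' :=
  #|[pred w : {ffun 'I_S -> bool} |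
     unlucky (extend_bits w) (n + i.+1) y y' (desc ch n k.+1 tau)]|.
have -> : \sum_(w : {ffun 'I_S -> bool}) (bad_luck (extend_bits w))%:R =
  \sum_(tau <- T) \sum_(i < k) \sum_(y <- Y (n + i.+1))
   \sum_(y' <- Y (n + i.+1).+1) (N tau i y y')%:R :> R.
  rewrite -natr_sum /bad_luck exchange_big natr_sum /=; apply: eq_bigr => t _.
  rewrite exchange_big natr_sum /=; apply: eq_bigr => i _.
  rewrite exchange_big natr_sum /=; apply: eq_bigr => y _.
  rewrite exchange_big natr_sum /=; apply: eq_bigr => y' _.
  by rewrite /N -sum1_card [in RHS]big_mkcond.
have T0 : 0 < (size T)%:R :> R by rewrite ltr0n T_size.
have bound tau (i : 'I_k) : tau \in T -> \sum_(y <- Y (n + i.+1))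
   \sum_(y' <- Y (n + i.+1).+1) (N tau i y y')%:R
   <= (2^-1) ^+ (n + i.+1) * (Om / (size T)%:R).
  move=> tT; set m := (n + i.+1)%N.
  have B0 : 0 < (B m)%:R :> R by rewrite ltr0n branching_gt0.
  have [Q QE] : exists Q : R, Q = (2 * #|{: U}| * inv_thr m)%:R ^+ 2 by eexists.
  apply: (@le_trans _ _ (\sum_(y <- Y m) \sum_(y' <- Y m.+1) Om * Q / (B
    m)%:R)).
    apply: ler_sum => y _; apply: ler_sum => y' _; rewrite ler_pdivlMr //.
    by rewrite QE; exact: unlucky_count.
  rewrite !(big_const_seq, count_predT, iter_addr_0) -mulrnA -[leLHS]mulr_natr.
  set a := (size (Y m.+1) * size (Y m))%N.
  have -> : (2^-1) ^+ m * (Om / (size T)%:R) =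
      Om * ((2 ^ m * size T)%:R^-1 : R).
    by rewrite natrM invfM natrX -exprVn mulrCA.
  rewrite -!mulrA; apply: ler_wpM2l => //.
  rewrite mulrCA ler_pdivrMl // ler_pdivlMr ?ltr0n ?muln_gt0 ?expn_gt0 ?T_size
    //.
  rewrite QE -natrX -!natrM ler_nat /branching.
  apply: leq_trans (leq_addr _ _).
  have Tq : ((size (Y n.+1)).+1 <= 2 * inv_thr m)%N.
    have : (size (Y n.+1) <= inv_thr m)%N.
      apply: leq_trans (leq_size_net_inv_thr _) (leq_inv_thr _).
      by rewrite /m addnS ltnS leq_addr.
    by have := inv_thr_gt0 m; lia.
  rewrite [leqRHS]mulnC -mulnA leq_mul2l; apply/orP; right.
  rewrite mulnCA leq_mul2l; apply/orP; right.
  rewrite /a mulnC -mulnA; apply: leq_mul => //.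
  by rewrite mulnC.
apply: (@le_trans _ _ (\sum_(tau <- T) (2^-1) ^+ n * (Om / (size T)%:R))).
  rewrite big_seq [leRHS]big_seq; apply: ler_sum => tau tT.
  apply: le_trans (ler_sum _ (fun i _ => bound tau i tT)) _.
  rewrite -mulr_suml; apply: ler_wpM2r; first by rewrite divr_ge0.
  have -> : \sum_(i < k) (2^-1 : R) ^+ (n + i.+1) = (2^-1) ^+ n - (2^-1) ^+ (n
    + k).
    elim: (k) => [|j IH]; first by rewrite big_ord0 addn0 subrr.
    by rewrite big_ord_recr /= IH addnS exprS; lra.
  by rewrite gerBl exprn_ge0 // invr_ge0.
rewrite big_const_seq count_predT iter_addr_0 -[leLHS]mulr_natr -mulrA.
by rewrite divfK ?gt_eqF.
Qed.

End union_bound.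
End fixed_shift.
End covering_probability.

(** * Borel sets of continuous functions *)

Lemma continuous_subr_const {R : realType} (W : normedModType R) (w : W) :
  continuous (fun v : W => v - w).
Proof. by move=> v; apply: cvgB; [exact: cvg_id|exact: cvg_cst]. Qed.

Section continuous_functions.
Context {R : realType} {K : metricType R} (cK : compact [set: K]) {d : nat}.
Local Notation V := 'rV[R]_d.
Local Notation C := (cont_space cK V).

Lemma cont_space_cts (f : C) : continuous (f : K -> V).
Proof. exact: cts_fun. Qed.

Lemma sup_norm_ge (f : C) x : `|f x| <= `|f|.
Proof.
apply: ub_le_sup; last by exists x.
have cf : {within [set: K], continuous (f : K -> V)}.
  by apply: continuous_subspaceT; exact: cont_space_cts.
have [M [_ fM]] := compact_bounded (continuous_compact cf cK).
exists (M + 1) => _ [y _ <-].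
by apply: (fM (M + 1)); [rewrite ltrDl | exists y].
Qed.

Lemma sup_norm_le (f : C) (e : R) : 0 <= e -> (forall x, `|f x| <= e) ->
  `|f| <= e.
Proof.
move=> e0 fe; have [[y Ky]|] := pselect (range (fun x => `|f x|) !=set0).
  by apply: ge_sup; [exists y | move=> _ [x _ <-]].
by move/set0P/negP; rewrite negbK => /eqP f0;
  rewrite /Num.norm/= /sup_norm f0 sup0.
Qed.

Lemma open_measurable_borel (O : set C) : open O ->
  measurable (O : set (borel C)).
Proof. by move=> oO; exact: sub_sigma_algebra. Qed.

Lemma closed_measurable_borel (F : set C) : closed F ->
  measurable (F : set (borel C)).
Proof.
move=> cF; rewrite -[F]setCK; apply: measurableC.
by apply: open_measurable_borel; exact: closed_openC.
Qed.

Lemma continuous_measurable_borel (h : C -> C) : continuous h ->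
  measurable_fun [set: borel C] (h : borel C -> borel C).
Proof.
move=> ch; apply: measurability; first by reflexivity.
move=> _ [W oW <-]; rewrite setTI; apply: (@open_measurable_borel (h @^-1` W)).
by apply: open_comp => [f _|]; [exact: ch|exact: oW].
Qed.

Definition covered (A1 A2 : set K) (y : V) (e : R) : set C :=
  [set f | forall y0, `|y0 - y| <= e ->
     (exists2 x, A1 x & f x = y0) /\ (exists2 x, A2 x & f x = y0)].

Lemma closed_image (A : set K) (f : C) : closed A -> closed (f @` A).
Proof.
move=> cA; apply: compact_closed; first exact: norm_hausdorff.
apply: continuous_compact; last first.
  by apply: subclosed_compact cA cK _.
by apply: continuous_subspaceT; exact: cont_space_cts.
Qed.

Lemma approx_image (A : set K) (f : C) (y : V) : closed A ->
  (forall e, 0 < e -> exists2 x, A x & `|f x - y| <= e) ->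
  exists2 x, A x & f x = y.
Proof.
move=> cA apx; suff : (f @` A) y by [].
apply: closed_image => // O /nbhs_ballP[e e0 eO].
have [x Ax fxy] := apx (e / 2) (divr_gt0 e0 (ltr0n R 2)).
exists (f x); split; first by exists x.
apply: eO; rewrite -ball_normE /= distrC; apply: le_lt_trans fxy _.
by rewrite ltr_pdivrMr // ltr_pMr // ltr1n.
Qed.

(** Membership in [covered] is an exact condition on values; it passes to
    uniform limits because the images of the compact sets [A1] and [A2] are
    closed. *)
Lemma closed_covered A1 A2 y e : closed A1 -> closed A2 ->
  closed (covered A1 A2 y e).
Proof.
move=> cA1 cA2 f clf y0 y0e.
have apx A : (forall f', covered A1 A2 y e f' -> exists2 x, A x & f' x = y0) ->
    forall r, 0 < r -> exists2 x, A x & `|f x - y0| <= r.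
  move=> hA r r0; have [f' [f'c ff']] := clf _ (nbhsx_ballx f r r0).
  have [x Ax f'x] := hA _ f'c; exists x => //; rewrite -f'x.
  apply: le_trans (sup_norm_ge (f - f') x) _.
  by move: ff'; rewrite -ball_normE /= => /ltW.
by split; apply: approx_image => //; apply: apx => f' /(_ _ y0e)[].
Qed.

End continuous_functions.

(** * The law of the random series *)

Section random_element.
Context {R : realType} {K : metricType R} (cK : compact [set: K]) {d : nat}.
Variables (P : nat -> seq K) (del : nat -> R).
Hypothesis P_uniq : forall m, uniq (P m).
Hypothesis del_gt0 : forall m, 0 < del m.
Hypothesis P_sep : forall m, separated (P m) (del m).
Local Notation V := 'rV[R]_d.
Local Notation C := (cont_space cK V).

Definition partial_element b n : C :=
  mkcts (@continuous_partial_map R K d P del b n).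

Definition limit_element b : C :=
  mkcts (@continuous_limit_map R K d P del P_uniq del_gt0 P_sep b).

Definition random_element (w : measurableTypeR R) : borel C :=
  limit_element (coin w).

Lemma limit_element_dist b n :
  `|limit_element b - partial_element b n| <= 3 * rad n.
Proof.
apply: sup_norm_le; first by rewrite mulr_ge0 // ltW // rad_gt0.
by move=> x; exact: limit_map_dist.
Qed.

(** For an open set [W], the limit of the series is in [W] exactly when some
    partial sum is so far inside [W] that the tail of the series cannot leave
    it, a condition on finitely many coins. *)
Lemma measurable_random_element : measurable_fun [set: measurableTypeR R]
  random_element.
Proof.
apply: measurability; first by reflexivity.
move=> _ [W oW <-]; rewrite setTI.
pose A n := [set b | forall f : C, `|f - partial_element b n| <= 3 * rad n -> W
  f].
have -> : random_element @^-1` W = \bigcup_n [set w | A n (coin w)].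
  apply/seteqP; split => [w /= Ww|w [n _]]; last first.
    by move=> /(_ (limit_element (coin w))); apply; exact: limit_element_dist.
  have /nbhs_ballP[e e0 eW] : nbhs (limit_element (coin w)) W.
    exact: open_nbhs_nbhs.
  have [n /(_ n (leqnn n)) ne] := rad_small (divr_gt0 e0 (ltr0n R 6)).
  exists n => // f fn; apply: eW; rewrite -ball_normE /=.
  have -> : limit_element (coin w) - f =
      (limit_element (coin w) - partial_element (coin w) n)
        - (f - partial_element (coin w) n).
    by rewrite opprB addrA subrK.
  apply: le_lt_trans (ler_normB _ _) _.
  by have := limit_element_dist (coin w) n; lra.
apply: bigcup_measurable => n _.
have [] := @coin_prob_finite_event R (num_coins (d := d) P n) (A n); last by [].
move=> b b' bb' Ab f;
  suff -> : partial_element b' n = partial_element b n by exact: Ab.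
by apply: cont_spaceP => x; apply: partial_map_eq => i /bb'.
Qed.

HB.instance Definition _ := isMeasurableFun.Build _ _ _ _ random_element
  measurable_random_element.

End random_element.

(** * Prevalence *)

Lemma infinitely_often_pigeonhole (I : eqType) (s : seq I) (Q : I -> nat ->
  Prop) :
  (forall M, exists2 j, (M <= j)%N & exists2 i, i \in s & Q i j) ->
  exists2 i, i \in s & forall M, exists2 j, (M <= j)%N & Q i j.
Proof.
elim: s => [|i s IH] io; first by have [j _ []] := io 0%N.
have [ioi|nioi] := pselect (forall M, exists2 j, (M <= j)%N & Q i j).
  by exists i; rewrite ?inE ?eqxx.
have [M noM] : exists M, forall j, (M <= j)%N -> ~ Q i j.
  apply: contrapT => no; apply: nioi => M; apply: contrapT => noM; apply: no.
  by exists M => j Mj Qj; apply: noM; exists j.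
have [|i' i's Qi'] := IH.
  move=> M'; have [j] := io (maxn M M').
  rewrite geq_max => /andP[Mj M'j] [i']; rewrite inE => /orP[/eqP ->|i's] Qj.
    by have := noM _ Mj.
  by exists j => //; exists i'.
by exists i' => //; rewrite inE i's orbT.
Qed.

Section prevalence.
Context {R : realType} {K : metricType R} (cK : compact [set: K]) {d : nat}.
Local Notation V := 'rV[R]_d.
Local Notation C := (cont_space cK V).
Variables (P : nat -> seq K) (del : nat -> R) (ch : nat -> K -> seq K).
Variable Y : nat -> seq V.
Local Notation B := (branching Y).
Hypothesis YP : forall m z, `|z| <= m%:R + 5 ->
  exists2 y, y \in Y m & `|z - y| <= rad m / 4.
Hypothesis P_uniq : forall m, uniq (P m).
Hypothesis del_gt0 : forall m, 0 < del m.
Hypothesis P_sep : forall m, separated (P m) (del m).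
Hypothesis P_net : forall m, del m.+1 <= m.+1%:R^-1 /\
  forall x, exists2 p, p \in P m.+1 & mdist p x < m.+1%:R^-1.
Hypothesis chP : forall m q, q \in P m ->
  [/\ uniq (ch m q), size (ch m q) = B m.+1, {subset ch m q <= P m.+1} &
      forall c x, c \in ch m q -> mdist c x <= del m.+1 -> mdist q x <= del m].

Definition cell m (p : K) : set K := [set x | mdist p x <= del m].

Lemma closed_cell m p : closed (cell m p).
Proof.
apply: (@closed_comp _ _ (mdist p) [set r : R | r <= del m]).
  by move=> x _; exact: continuous_mdist.
exact: closed_le.
Qed.

Definition triples n : seq (K * K * V) :=
  [seq (pr, y) | pr <- [seq (t, t') | t <- P n, t' <- P n], y <- Y n.+1].

(** A Borel way of saying that the cell of [q] is doubly covered: countably many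
    pairs of cells and centers [y] of the common ball are enough. *)
Definition robust k q : set C :=
  \bigcup_n \bigcup_(t in [set t : K * K * V | t \in triples n /\
     [/\ t.1.1 != t.1.2, cell n t.1.1 `<=` cell k q & cell n t.1.2 `<=` cell k
       q]])
   covered (cK := cK) (cell n t.1.1) (cell n t.1.2) t.2 (rad n.+1 / 4).

Lemma measurable_robust k q : measurable (robust k q : set (borel C)).
Proof.
apply: bigcup_measurable => n _; apply: fin_bigcup_measurable.
  by apply: (@sub_finite_set _ _ [set` triples n]) => [t []|];
    last exact: finite_seq.
move=> t _; apply: closed_measurable_borel.
by apply: closed_covered; exact: closed_cell.
Qed.

Definition good : set C := \bigcap_k \bigcap_(q in [set` P k]) robust k q.

(** Every open set contains a cell, and the nets provide a countable base. *)
Lemma good_comeager (f : C) : good f ->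
  comeager [set y : set_type (range f) | perfect_set (f @^-1` [set set_val y])].
Proof.
move=> gf.
(* [nb m i] is the ball around the point of index [i], written as a union over
   all the points with this index because [K] may be empty. *)
pose nb m i := \bigcup_(p in [set p | p \in P m.+1 /\ index p (P m.+1) = i])
  (ball p m.+1%:R^-1 : set K)^°.
pose N n := if unpickle n is Some mi then nb mi.1 mi.2 else set0.
have small (x : K) (A : set K) : nbhs x A -> exists m, ball x (m.+1%:R^-1 +
  m.+1%:R^-1) `<=` A.
  move=> /nbhs_ballP[e e0 eA].
  have [m _ /(_ m (leqnn m)) /= me] :=
    near_infty_natSinv_lt (PosNum (divr_gt0 e0 (ltr0n R 2))).
  exists m; apply: subset_trans eA; apply: le_ball; rewrite [e]splitr.
  by apply: lerD; exact: ltW.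
have inball m p x : mdist p x < m.+1%:R^-1 -> ((ball p m.+1%:R^-1 : set K)^°) x.
  move=> px; apply: open_nbhs_nbhs; split; last by rewrite ballEmdist.
  rewrite ballEmdist;
    apply: (open_comp (f := mdist p) (D := [set r : R | r < m.+1%:R^-1])).
    by move=> y _; exact: continuous_mdist.
  exact: open_lt.
apply: (@comeager_perfect_fibers K V f N).
- by apply: hausdorff_accessible; exact: norm_hausdorff.
- exact: cont_space_cts.
- move=> n; rewrite /N; case: (unpickle n) => [[m i]|]; last exact: open0.
  by apply: bigcup_open => p _; exact: open_interior.
- move=> x A /small[m mA].
  have [_ /(_ x)[p pP px]] := P_net m.
  exists (pickle (m, index p (P m.+1))); rewrite /N pickleK /=; split.
    by exists p => //; exact: inball.
  move=> y [p' [/= p'P pp']] /interior_subset p'y; apply: mA.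
  have p'E : p' = p by rewrite -(nth_index p p'P) pp' nth_index.
  apply: (@ball_triangle _ _ p); last by rewrite -p'E.
  by apply: ball_sym; rewrite ballEmdist.
move=> W oW [x Wx].
have [m mW] := small x W (open_nbhs_nbhs (conj oW Wx)).
have [dm /(_ x)[p pP px]] := P_net m.
have pW : cell m.+1 p `<=` W.
  move=> y py; apply: mW; rewrite ballEmdist /=.
  apply: le_lt_trans (metric_triangle x p y) _.
  have -> : mdist x p = mdist p x by exact: metric_sym.
  by apply: ltr_leD => //; exact: le_trans py dm.
have [n _ [[[t t'] y] /= [tri [tt' tp t'p]] cov]] := gf m.+1 I p pP.
exists (cell n t), (cell n t'), (ball y (rad n.+1 / 4)).
have [tP t'P] : t \in P n /\ t' \in P n.
  by move: tri => /allpairsP[[[a b] c] /= [/allpairsP[[a' b'] /= [? ? [-> ->]]]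
    _ [-> -> _]]].
split.
- exact: subset_trans tp pW.
- exact: subset_trans t'p pW.
- apply/seteqP; split => // z [/= tz t'z]; apply/negP: tt'; rewrite negbK.
  by apply/eqP; exact: (cells_disjoint del_gt0 P_sep tP t'P tz t'z).
- split; first exact: ball_open.
  by exists y; apply: ballxx; rewrite divr_gt0 // rad_gt0.
- by split=> z; rewrite -ball_normE /= => /ltW; rewrite distrC => /cov[].
Qed.

Local Notation Phi := (random_element cK P_uniq del_gt0 P_sep (d := d)).

(** Only finitely many pairs of cells and centers are available, so one of them
    occurs for infinitely many horizons, and compactness of the two cells turns
    the approximate values into exact ones. *)
Lemma cover_limit (x0 : C) (b : nat -> bool) n (T : seq K) :
  {subset T <= P n} ->
  (forall M, exists2 j, (M <= j)%N & double_cover P del Y (fun x => - x0 x) n T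
    b j) ->
  exists t t' y, [/\ t \in T, t' \in T, t != t', y \in Y n.+1 &
    covered (cell n t) (cell n t') y (rad n.+1 / 4)
      (limit_element cK P_uniq del_gt0 P_sep b - x0 : C)].
Proof.
move=> TP io; pose g x := - x0 x.
pose Q (t : K * K * V) j := [/\ t.1.1 \in T, t.1.2 \in T, t.1.1 != t.1.2,
  t.2 \in Y n.+1 & forall y0, `|y0 - t.2| <= rad n.+1 / 4 ->
    near_image P del g n b j t.1.1 y0 /\ near_image P del g n b j t.1.2 y0].
have [|[[t t'] y] _ ioQ] := @infinitely_often_pigeonhole _
    [seq (pr, y) | pr <- [seq (t, t') | t <- T, t' <- T], y <- Y n.+1] Q.
  move=> M; have [j Mj [t [t' [y [tT t'T tt' yY cov]]]]] := io M.
  exists j => //; exists (t, t', y) => //.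
  apply/allpairsP; exists ((t, t'), y); split => //=.
  by apply/allpairsP; exists (t, t').
have [_ _ [/= tT t'T tt' yY _]] := ioQ 0%N.
exists t, t', y; split => // y0 y0y.
have near_approx s : s \in T ->
    (forall M, exists2 j, (M <= j)%N & near_image P del g n b j s y0) ->
    exists2 x, cell n s x & (limit_element cK P_uniq del_gt0 P_sep b - x0 : C)
      x = y0.
  move=> sT io'; apply: approx_image; first exact: closed_cell.
  move=> e e0; have [M MP] := rad_small (divr_gt0 e0 (ltr0n R 5)).
  have [j Mj [x [sx xy]]] := io' M.
  exists x => //.
  have -> : (limit_element cK P_uniq del_gt0 P_sep b - x0 : C) x - y0 =
      (limit_map P del b x - partial_map P del b (n + j.+1) x)
      + (partial_map P del b (n + j.+1) x + g x - y0).
    by rewrite !addrA subrK.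
  have rN : rad (n + j.+1) < e / 5.
    by apply: MP; apply: leq_trans Mj _; rewrite addnS leqW // leq_addl.
  apply: le_trans (ler_normD _ _) _.
  apply: le_trans (lerD (limit_map_dist P_uniq del_gt0 P_sep b _ x) xy) _.
  by lra.
split; apply: near_approx => // M; have [j Mj [_ _ _ _ cov]] := ioQ M;
  by exists j => //; have [] := cov _ y0y.
Qed.

Lemma double_cover_eq (g : K -> V) n T b b' j :
  (forall i, (i < num_coins (d := d) P (n + j.+1))%N -> b i = b' i) ->
  double_cover P del Y g n T b j -> double_cover P del Y g n T b' j.
Proof.
move=> bb' [t [t' [y [tT t'T tt' yY cov]]]]; exists t, t', y;
  split => // y0 y0y.
have near s : near_image P del g n b j s y0 -> near_image P del g n b' j s y0.
  move=> [x [sx xy]]; exists x; split => //.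
  by rewrite -(partial_map_eq del x bb').
by have [/near ? /near ?] := cov _ y0y.
Qed.

Lemma double_cover_prob (g : K -> V) n T j : (forall x, `|g x| <= n%:R) ->
  {subset T <= P n} -> uniq T -> size T = (size (Y n.+1)).+1 ->
  let E := [set w | ~ double_cover P del Y g n T (coin w) j] : set
    (measurableTypeR R) in
  measurable E /\ (coin_prob E <= ((2^-1) ^+ n)%:E)%E.
Proof.
move=> gn TP uT sT E; pose S := num_coins (d := d) P (n + j.+1).
have [|mE le] := @coin_prob_finite_event R S
    [set b | ~ double_cover P del Y g n T b j].
  by move=> b b' bb' nd /double_cover_eq db; apply: nd; apply: db => i /bb'.
split; first exact: mE.
apply: le_trans le _; rewrite lee_fin.
have := double_cover_count YP P_uniq del_gt0 P_sep chP gn TP uT sT (leqnn S).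
rewrite card_ffun card_bool card_ord natrX.
rewrite (_ : #|_| = #|[pred v : {ffun 'I_S -> bool} |
  `[< [set b | ~ double_cover P del Y g n T b j] (extend_bits v) >]]|);
    last first.
  by apply: eq_card => v; rewrite !inE asbool_neg.
by rewrite [X in _ * X <= _]exprVn ler_pdivrMr ?exprn_gt0.
Qed.

(** Failure at all large horizons is at most as likely as failure at one of
    them. *)
Lemma coin_prob_eventually_le (F : nat -> set (measurableTypeR R)) (e : R) :
  (forall j, measurable (F j) /\ (coin_prob (F j) <= e%:E)%E) ->
  let E := \bigcup_M \bigcap_(j in [set j | (M <= j)%N]) F j in
  measurable E /\ (coin_prob E <= e%:E)%E.
Proof.
move=> mF E.
have mI M : measurable (\bigcap_(j in [set j | (M <= j)%N]) F j).
  by apply: bigcap_measurable => [|j _]; [exists M => /=|have [] := mF j].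
have mE : measurable E by exact: bigcup_measurable.
split => //.
have nd : nondecreasing_seq (fun M => \bigcap_(j in [set j | (M <= j)%N]) F j).
  move=> M M' MM'; apply/subsetPset => w h j /= M'j; apply: h => /=.
  exact: leq_trans MM' M'j.
have cv := nondecreasing_cvg_mu (mu := coin_prob) mI mE nd.
rewrite -(cvg_lim _ cv) //; apply: lime_le; first by apply: cvgP cv.
apply: nearW => M; apply: le_trans (mF M).2.
apply: le_measure; rewrite ?inE //; first exact: (mF M).1.
by apply: bigcap_inf => /=.
Qed.

(** The shift enters as [g := - x0].  Starting the argument at the children of a
    descendant of [q] of a level that is large, in particular larger than the
    norm of [x0], bounds the probability of failure by [2^-n] for every large
    [n]. *)
Lemma robust_null k q (x0 : C) : q \in P k ->
  let E := Phi @^-1` [set f : borel C | ~ robust k q ((f : C) - x0)] in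
  measurable E /\ coin_prob E = 0%E.
Proof.
move=> qP E.
have mE : measurable E.
  rewrite -[E]setTI;
    apply: (measurable_random_element (cK := cK) P_uniq del_gt0 P_sep) => //.
  have mB : measurable (~` robust k q : set (borel C)).
    by apply: measurableC; exact: measurable_robust.
  have := continuous_measurable_borel (@continuous_subr_const R C x0).
  by move=> /(_ measurableT _ mB); rewrite setTI.
split => //.
have small n' : (k <= n')%N -> `|x0| <= n'.+1%:R ->
    (coin_prob E <= ((2^-1) ^+ n'.+1)%:E)%E.
  move=> kn' x0n.
  pose g x := - x0 x.
  have gn x : `|g x| <= n'.+1%:R by rewrite normrN (le_trans (sup_norm_ge x0
    x)).
  have [q' q'q] : exists q', q' \in desc ch k (n' - k) q.
    have := size_desc chP (n' - k) qP.
    have : (0 < ndesc B k (n' - k))%N by apply: ndesc_gt0; exact: branching_gt0.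
    case: (desc ch k (n' - k) q) => [/[swap] <- //|q' s _ _].
    by exists q'; rewrite inE eqxx.
  have q'P : q' \in P n' by have := desc_level chP qP q'q; rewrite subnKC.
  have q'cell : cell n' q' `<=` cell k q.
    by move=> x q'x; apply: (desc_cell chP qP q'q); rewrite subnKC.
  have [uch sch chsub chc] := chP q'P.
  (* One starting point more than there are initial targets. *)
  pose T := take (size (Y n'.+2)).+1 (ch n' q').
  have Tch : {subset T <= ch n' q'} by exact: mem_take.
  have TP : {subset T <= P n'.+1} by move=> t /Tch /chsub.
  have uT : uniq T by exact: take_uniq.
  have sT : size T = (size (Y n'.+2)).+1.
    by rewrite size_takel // sch /branching leq_addl.
  have [mU leU] := coin_prob_eventually_le
    (fun j => double_cover_prob j gn TP uT sT).
  apply: le_trans leU; apply: le_measure; rewrite ?inE // => w Ew.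
  apply: contrapT => nU; apply: Ew.
  have [|t [t' [y [tT t'T tt' yY cov]]]] := @cover_limit x0 (coin w) _ T TP.
    move=> M; apply: contrapT => noM; apply: nU; exists M => // j /= Mj dc.
    by apply: noM; exists j.
  exists n'.+1 => //; exists ((t, t'), y) => //=; split.
    apply/allpairsP; exists ((t, t'), y); split => //=.
    by apply/allpairsP; exists (t, t'); split => //; exact: TP.
  by split => // x /chc h; apply: q'cell; apply: h; exact: Tch.
apply/eqP; rewrite eq_le measure_ge0 andbT; apply/lee_addgt0Pr => e e0.
rewrite add0e.
have lt1 : `|2^-1 : R| < 1 by rewrite ger0_norm; lra.
have /cvgrPdist_lt/(_ _ e0)[N _ NP] := cvg_geometric 1 lt1.
pose n' := maxn (maxn k N) (Num.trunc `|x0|).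
apply: le_trans (small n' _ _) _.
- by rewrite !leq_max leqnn.
- by apply/ltW; apply: lt_le_trans (truncnS_gt _) _;
  rewrite ler_nat ltnS leq_maxr.
have := NP n'.+1;
  rewrite /= sub0r normrN mul1r ger0_norm ?exprn_ge0 ?invr_ge0 //.
by rewrite lee_fin => h; apply/ltW/h;
  rewrite leqW // leq_max leq_max leqnn orbT.
Qed.

End prevalence.

Theorem theorem5p1 (R : realType) (K : metricType R)
    (cK : compact [set: K]) (iK : isolated [set: K] = set0)
    (d : nat) (d_gt0 : (0 < d)%N) :
  prevalent R [set f : cont_space cK 'rV[R]_d |
    comeager [set y : set_type (range f) |
      perfect_set (f @^-1` [set set_val y])]].
Proof.
have [Y YP] : exists Y : nat -> seq 'rV[R]_d, forall m z, `|z| <= m%:R + 5 ->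
    exists2 y, y \in Y m & `|z - y| <= rad m / 4.
  have net m : exists s : seq 'rV[R]_d, forall z, `|z| <= m%:R + 5 ->
      exists2 y, y \in s & `|z - y| <= rad m / 4.
    by apply: exists_ball_net; rewrite divr_gt0 // rad_gt0.
  by have [Y YP] := choice net; exists Y.
have [P [del [ch [P_uniq del_gt0 P_sep P_net chP]]]] :=
  exists_scheme cK iK (branching Y).
pose Phi := random_element cK (d := d) P_uniq del_gt0 P_sep.
pose Good := good (cK := cK) P del Y.
have mGood : measurable (~` Good : set (borel (cont_space cK 'rV[R]_d))).
  apply: measurableC; apply: bigcap_measurable => [|k _]; first by exists 0%N.
  apply: fin_bigcap_measurable => [|q _]; first exact: finite_seq.
  exact: measurable_robust.
exists (~` Good), (distribution coin_prob Phi).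
split => //.
- move=> f nf gf; apply: nf; exact: (good_comeager del_gt0 P_sep P_net gf).
move=> x0; set S := [set _ | _ in _].
pose E k q := Phi @^-1` [set f : borel (cont_space cK 'rV[R]_d) |
  ~ robust (cK := cK) P del Y k q ((f : cont_space cK 'rV[R]_d) - x0)].
have SE : Phi @^-1` S = \bigcup_k \bigcup_(q in [set` P k]) E k q.
  apply/seteqP; split => w.
    move=> [f ngf fw]; apply: contrapT => nE; apply: ngf => k _ q qP.
    apply: contrapT => nr; apply: nE; exists k => //; exists q => //=.
    by rewrite /E /= -fw addrK.
  move=> [k _ [q qP nr]]; exists (Phi w - x0); last exact: subrK.
  by move=> gf; apply: nr; exact: gf.
have EP k q : q \in P k -> measurable (E k q) /\ coin_prob (E k q) = 0%E.
  by move=> qP; exact: (robust_null YP P_uniq del_gt0 P_sep chP x0 qP).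
have mS : measurable (Phi @^-1` S).
  rewrite SE; apply: bigcup_measurable => k _.
  by apply: fin_bigcup_measurable => [|q /EP[]//]; exact: finite_seq.
suff : coin_prob (Phi @^-1` S) = 0%E by [].
apply: measure_negligible => //.
rewrite SE; apply: negligible_bigcup => k.
have : {subset P k <= P k} by [].
elim: {1 3}(P k) => [|q s IH] sP; first by rewrite set_nil bigcup_set0;
  exact: negligible_set0.
have -> : [set` q :: s] = q |` [set` s].
  by apply/seteqP; split => x /=; rewrite inE => /predU1P.
rewrite bigcup_setU1; apply: negligibleU.
  have [mE E0] := EP k q (sP q (mem_head _ _)).
  by apply/negligibleP.
by apply: IH => q' q's; apply: sP; rewrite inE q's orbT.
Qed.
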